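(* Let $d\ge3$ be an integer and $\beta_c=\operatorname{atanh}(1/(d-1))$. For any $\beta>\beta_c$, $B_c^G(\beta)=\hat B_c(\beta)$, where $B_c^G(\beta)$ is the critical external field for uniqueness of the Gibbs measure of the Ising model on the infinite $d$-regular tree, and $\hat B_c(\beta)$ is the critical external field of the annealed Ising model on the $d$-regular configuration model.
   Context: $B_c^G(\beta)=\inf\{B\ge0:$ the ferromagnetic Ising model with inverse temperature $\beta$ and uniform external field $B$ (interaction $\beta\sigma_u\sigma_v$ on each edge, field term $B\sigma_v$ at each vertex) on the infinite tree in which every vertex has degree $d$ has a unique Gibbs measure$\}$. Let $I(t)=(t-1)\log(1-t)-t\log t$ (with $I(0)=I(1)=0$), $$f_\beta(t)=\frac{e^{-2\beta}(1-2t)+\sqrt{1+(e^{-4\beta}-1)(1-2t)^2}}{2(1-t)},$$ $$\hat\varphi_{\beta,0}(t)=\frac{\beta d}{2}+I(t)+d\int_0^{\min(t,1-t)}\log f_\beta(s)\,ds,\qquad t\in[0,1].$$ Then $\hat B_c(\beta)=\sup_{t\in(0,1/2)}\big(-\tfrac12\hat\varphi_{\beta,0}'(t)\big)$. *)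

(* Defs.v *)
From HB Require Import structures.
From mathcomp Require Import all_boot all_order all_algebra finmap.
From mathcomp Require Import all_classical all_reals all_analysis.

Set Implicit Arguments.
Unset Strict Implicit.
Unset Printing Implicit Defensive.

Import Order.TTheory GRing.Theory Num.Theory.
Import numFieldNormedType.Exports.

Local Open Scope classical_set_scope.
Local Open Scope ring_scope.

(** * Ising Gibbs measures on a locally finite graph

    A locally finite simple graph on [V] is given by its neighbourhood map
    [N : V -> {fset V}].  A spin configuration is a map [V -> bool], where
    [true] stands for the spin +1 and [false] for the spin -1. *)

Definition spin (R : realType) (b : bool) : R := if b then 1 else -1.

Definition spin_cylinders (V : choiceType) : set (set (V -> bool)) :=
  [set C | exists (v : V) (b : bool), C = [set sigma | sigma v = b]].

(* {-1, +1}^V with its product sigma-algebra. *)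
Notation spin_space V := (g_sigma_algebraType (@spin_cylinders V)).

(* Unordered pairs, so that an edge with both ends in L counts once. *)
Definition edges_meeting (V : choiceType) (N : V -> {fset V}) (L : {fset V}) :
    {fset {fset V}} :=
  [fset [fset u; v]%fset | u in L, v in N u]%fset.

Definition boltzmann_weight (R : realType) (V : choiceType) (N : V -> {fset V})
    (beta B : R) (L : {fset V}) (sigma : V -> bool) : R :=
  expR (beta * (\sum_(e <- edges_meeting N L) \prod_(v <- e) spin R (sigma v))
        + B * (\sum_(v <- L) spin R (sigma v))).

Definition glue_config (V : choiceType) (L : {fset V}) (eta : {ffun L -> bool})
    (tau : V -> bool) : V -> bool :=
  fun v => if insub v is Some w then eta w else tau v.

Definition ising_kernel (R : realType) (V : choiceType) (N : V -> {fset V})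
    (beta B : R) (L : {fset V}) (A : set (V -> bool)) (tau : V -> bool) : R :=
  (\sum_(eta : {ffun L -> bool})
      boltzmann_weight N beta B L (glue_config eta tau) * \1_A (glue_config eta tau))
  / (\sum_(eta : {ffun L -> bool}) boltzmann_weight N beta B L (glue_config eta tau)).

(* The Dobrushin-Lanford-Ruelle equations, as invariance of mu under the
   finite-volume kernels. *)
Definition is_ising_gibbs (R : realType) (V : choiceType) (N : V -> {fset V})
    (beta B : R) (mu : probability (spin_space V) R) : Prop :=
  forall (L : {fset V}) (A : set (spin_space V)), measurable A ->
    mu A = (\int[mu]_tau (ising_kernel N beta B L A tau)%:E)%E.

(* Measures are compared on measurable sets only: the underlying set function
   of a [probability] is unconstrained elsewhere. *)
Definition unique_ising_gibbs (R : realType) (V : choiceType)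
    (N : V -> {fset V}) (beta B : R) : Prop :=
  exists mu : probability (spin_space V) R,
    is_ising_gibbs N beta B mu /\
    forall nu : probability (spin_space V) R, is_ising_gibbs N beta B nu ->
      forall A : set (spin_space V), measurable A -> nu A = mu A.

(** * The infinite d-regular tree

    It is realised as the Cayley graph of the free product of d copies of Z/2:
    the vertices are the words over ['I_d] without two equal consecutive
    letters, and [u] is joined to [i u] for each letter [i], with [i i] = 1.
    [regular_tree_nbrP] below checks that this is a d-regular tree. *)

Definition reduced (d : nat) (s : seq 'I_d) : bool :=
  sorted (fun i j => i != j) s.

Definition tree_vertex (d : nat) : choiceType := {s : seq 'I_d | reduced s}.

Definition letter_mul (d : nat) (i : 'I_d) (s : seq 'I_d) : seq 'I_d :=
  if s is j :: s' then if i == j then s' else i :: s else [:: i].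

Lemma reduced_letter_mul d (i : 'I_d) s : reduced s -> reduced (letter_mul i s).
Proof.
case: s => [|j s] //=; case: (eqVneq i j) => [_|ij] /= js.
  exact: path_sorted js.
by rewrite /reduced /= ij.
Qed.

Definition tree_step (d : nat) (i : 'I_d) (u : tree_vertex d) : tree_vertex d :=
  exist _ (letter_mul i (val u)) (reduced_letter_mul i (valP u)).

Definition tree_nbr (d : nat) (u : tree_vertex d) : {fset tree_vertex d} :=
  [fset tree_step i u | i in 'I_d]%fset.

Definition is_regular_tree (d : nat) (V : choiceType) (N : V -> {fset V}) :=
  let adj := fun u v : V => v \in N u in
  [/\ symmetric adj /\ irreflexive adj,
      forall u, #|` N u|%fset = d,
      forall u v, exists2 p, path adj u p & last u p = v
    & forall c, ucycle adj c -> (size c <= 2)%N].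

Lemma letter_mulK d (i : 'I_d) s :
  reduced s -> letter_mul i (letter_mul i s) = s.
Proof.
case: s => [|j s] /=; first by rewrite eqxx.
case: (eqVneq i j) => [->|ij] /=; last by rewrite eqxx.
by case: s => [|k s] //= /andP[/negbTE ->].
Qed.

Lemma tree_stepK d (i : 'I_d) : involutive (@tree_step d i).
Proof. by move=> u; apply/val_inj; exact: (letter_mulK i (valP u)). Qed.

Lemma tree_step_inj d (u : tree_vertex d) : injective (fun i => tree_step i u).
Proof.
move=> i j /(congr1 val) /=; case: (val u) => [[]|k s] //=.
case: (eqVneq i k) => [->|ik]; case: (eqVneq j k) => [->|jk] //=.
- by move=> /(congr1 size) /= /eqP; rewrite -[X in X == _]addn0 -addn2 eqn_add2l.
- by move=> /(congr1 size) /= /eqP; rewrite eq_sym -[X in X == _]addn0 -addn2 eqn_add2l.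
- by case.
Qed.

Lemma tree_nbrE d (u v : tree_vertex d) :
  reflect (exists i, v = tree_step i u) (v \in tree_nbr u).
Proof.
apply: (iffP idP) => [/imfsetP[i _ ->]|[i ->]]; first by exists i.
by apply/imfsetP; exists i.
Qed.

(* Of two adjacent vertices, one is the tail of the other. *)
Lemma tree_nbr_tail d (u v : tree_vertex d) : v \in tree_nbr u ->
  (size (val u) < size (val v) /\ val u = behead (val v))%N \/
  (size (val v) < size (val u) /\ val v = behead (val u))%N.
Proof.
move=> /tree_nbrE[i ->] /=; case: (val u) => [|j s] /=; first by left.
by case: eqVneq => _ /=; [right|left].
Qed.

Lemma tree_nbr_sym d :
  symmetric (fun u v : tree_vertex d => v \in tree_nbr u).
Proof.
by move=> u v; apply/tree_nbrE/tree_nbrE => -[i ->]; exists i;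
  rewrite tree_stepK.
Qed.

Lemma regular_tree_nbrP d : is_regular_tree d (@tree_nbr d).
Proof.
have sym := @tree_nbr_sym d.
split.
- split=> // u; apply/negP => /tree_nbr_tail[]; by rewrite ltnn => -[].
- move=> u; rewrite card_imfset /=; last exact: tree_step_inj.
  by rewrite -[RHS](card_ord d) cardE.
- pose adj (u v : tree_vertex d) := v \in tree_nbr u.
  have root_path : exists r, forall u, exists2 p, path adj u p & last u p = r.
    have r0 : reduced ([::] : seq 'I_d) by [].
    exists (exist _ [::] r0) => -[s]; elim: s => [|i s IHs] rs.
      by exists [::] => //; exact/val_inj.
    have rs' : reduced s by exact: path_sorted rs.
    have [p p1 p2] := IHs rs'; exists (exist _ s rs' :: p) => //=.
    rewrite p1 andbT; apply/tree_nbrE; exists i; apply/val_inj => /=.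
    by rewrite eqxx.
  have [r rP] := root_path; move=> u v.
  have [p p1 p2] := rP u; have [q q1 q2] := rP v.
  exists (p ++ rev (belast v q)).
    rewrite cat_path p1 /= p2 -q2 rev_path.
    by rewrite (eq_path (e' := adj)) // => x y; rewrite /adj -sym.
  rewrite last_cat; case: q q1 q2 => [|w q] /= q1 q2; first by rewrite p2 q2.
  by rewrite rev_cons last_rcons.
- pose adj (u v : tree_vertex d) := v \in tree_nbr u.
  move=> c /andP[cc uc]; rewrite leqNgt; apply/negP => c3.
  (* the two neighbours of a longest word on a cycle both equal its tail *)
  have [m mc mmax] : exists2 m, m \in c &
      forall x, x \in c -> (size (val x) <= size (val m))%N.
    have c0 : (0 < size c)%N by apply: leq_trans c3.
    elim: {cc uc c3} c c0 => // a [|b c] IHc _.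
      by exists a; rewrite ?mem_head // => x; rewrite inE => /eqP ->.
    have [//|m mc mmax] := IHc.
    case: (leqP (size (val a)) (size (val m))) => am.
      by exists m => [|x]; rewrite inE ?mc ?orbT // => /predU1P[->|/mmax].
    exists a => [|x]; rewrite inE ?eqxx // => /predU1P[->//|/mmax xm].
    by apply: leq_trans xm _; exact: ltnW.
  have [i s sE] := rot_to mc.
  have : cycle adj (m :: s) by rewrite -sE rot_cycle.
  have : uniq (m :: s) by rewrite -sE rot_uniq.
  have ms x : x \in m :: s -> (size (val x) <= size (val m))%N.
    by rewrite -sE mem_rot; exact: mmax.
  have : (2 < size (m :: s))%N by rewrite -sE size_rot.
  case: s {sE} ms => [//|x s] ms; case/lastP: s ms => [//|s y] ms _.
  move=> /= /and3P[_]; rewrite mem_rcons inE negb_or => /andP[/eqP xy _] _.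
  rewrite rcons_path last_rcons => /and3P[mx _ ym].
  have tail z : z \in m :: x :: rcons s y -> z \in tree_nbr m ->
      val z = behead (val m).
    move=> /ms zm /tree_nbr_tail[[mz _]|[_ //]].
    by move: zm; rewrite leqNgt mz.
  apply: xy; apply/val_inj; rewrite (tail x) ?(tail y) //.
  + by rewrite !inE mem_rcons mem_head !orbT.
  + by move: ym; rewrite /adj sym.
  + by rewrite !inE eqxx orbT.
Qed.

(** * Critical fields

    The infimum and the supremum are taken in the extended reals, so that no
    default value of [inf] or [sup] on [R] can occur. *)

Definition critical_field_gibbs (R : realType) (d : nat) (beta : R) : \bar R :=
  ereal_inf [set B%:E | B in
    [set B : R | 0 <= B /\ unique_ising_gibbs (@tree_nbr d) beta B]].

Definition atanh (R : realType) (x : R) : R := ln ((1 + x) / (1 - x)) / 2.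

Definition beta_crit (R : realType) (d : nat) : R := atanh (d%:R - 1)^-1.

Definition entropy (R : realType) (t : R) : R :=
  (t - 1) * ln (1 - t) - t * ln t.

Definition f_ann (R : realType) (beta t : R) : R :=
  (expR (- 2 * beta) * (1 - 2 * t)
   + Num.sqrt (1 + (expR (- 4 * beta) - 1) * (1 - 2 * t) ^+ 2))
  / (2 * (1 - t)).

Definition phi_ann (R : realType) (d : nat) (beta t : R) : R :=
  beta * d%:R / 2 + entropy t
  + d%:R * Rintegral lebesgue_measure `[0, Num.min t (1 - t)]
             (fun s => ln (f_ann beta s)).

Definition critical_field_annealed (R : realType) (d : nat) (beta : R) : \bar R :=
  ereal_sup [set (- (1 / 2) * (derive1 (phi_ann d beta) t : R))%:E | t in
    [set t : R | 0 < t < 1 / 2]].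

(* Main.v *)
(** A message [l] solving [l = u (B + (d - 1) l)], with
    [u h = atanh (tanh beta * tanh h)], defines a Gibbs measure on the tree by
    adding the field [l] for every missing neighbour of a finite subtree:
    summing out a leaf only replaces its interaction by such a field, so the
    finite-volume laws are consistent.  Distinct messages give distinct
    marginals at the origin.  Conversely, summing out the leaves of a large
    subtree with an arbitrary boundary condition gives messages between the
    iterates of [l |-> u (B + (d - 1) l)] started at [- beta] and [beta]; if
    these have the same limit, the Gibbs measure is unique.

    Let [g h = h - (d - 1) u h].  A fixed message has [h = B + (d - 1) l] with
    [g h = B].  For [B > 0] there is at most one [h > 0] (by concavity of [u]),
    none [h < 0] if [B] exceeds [g] there, and two distinct fixed messages if
    [0 <= B < g h] for some [h < 0].  So the Gibbs critical field is the
    supremum of [g] over [h < 0].  On the annealed side, the change of variable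
    [t / (1 - t) = e^(2 h) * f t], under which [ln (f t) = 2 u h], turns
    [- phi' t / 2] into [g h] and maps [0 < t < 1/2] onto [h < 0]. *)

Require Import Defs.
From HB Require Import structures.
From mathcomp Require Import all_boot all_order all_algebra finmap.
From mathcomp Require Import all_classical all_reals all_analysis measurable_realfun.
From mathcomp Require Import ring lra.

Set Implicit Arguments.
Unset Strict Implicit.
Unset Printing Implicit Defensive.

Import Order.TTheory GRing.Theory Num.Theory.
Import numFieldNormedType.Exports.

Local Open Scope classical_set_scope.
Local Open Scope ring_scope.

(** * Finite-volume sums and cylinders *)

Section SiteSums.
Variables (R : realType) (V : choiceType).
Implicit Types (L M : {fset V}) (sigma tau zeta : V -> bool).
Implicit Type Phi : (V -> bool) -> R.

Definition upd sigma (v : V) (b : bool) : V -> bool :=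
  fun w => if w == v then b else sigma w.

(** The numerator and the denominator of [ising_kernel] both have this form. [Phi] takes
    configurations on all of [V], so that sums over different volumes can be nested. *)
Definition gsum L Phi tau : R :=
  \sum_(eta : {ffun L -> bool}) Phi (glue_config eta tau).

Definition site_sum (v : V) Phi sigma : R :=
  Phi (upd sigma v true) + Phi (upd sigma v false).

Lemma upd_same sigma v b : upd sigma v b v = b.
Proof. by rewrite /upd eqxx. Qed.

Lemma upd_other sigma v b w : w != v -> upd sigma v b w = sigma w.
Proof. by rewrite /upd => /negbTE ->. Qed.

Lemma upd_id sigma v : upd sigma v (sigma v) = sigma.
Proof. by apply/funext => w; rewrite /upd; case: eqP => [->|]. Qed.

Lemma glue_val L (eta : {ffun L -> bool}) tau (w : L) :
  glue_config eta tau (val w) = eta w.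
Proof. by rewrite /glue_config valK. Qed.

Lemma glue_notin L (eta : {ffun L -> bool}) tau v :
  v \notin L -> glue_config eta tau v = tau v.
Proof. by move=> vL; rewrite /glue_config insubN. Qed.

Lemma glue_in L (eta : {ffun L -> bool}) tau tau' v :
  v \in L -> glue_config eta tau v = glue_config eta tau' v.
Proof. by move=> vL; rewrite /glue_config insubT. Qed.

Lemma glue_restrict L sigma tau :
  glue_config [ffun w : L => sigma (val w)] tau =
  fun v => if v \in L then sigma v else tau v.
Proof.
apply/funext => v; case: ifPn => vL; last exact: glue_notin.
by rewrite /glue_config insubT ffunE.
Qed.

Lemma eq_gsum L Phi Psi tau :
  (forall sigma, (forall v, v \notin L -> sigma v = tau v) ->
    Phi sigma = Psi sigma) ->
  gsum L Phi tau = gsum L Psi tau.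
Proof. by move=> eqP; apply: eq_bigr => eta _; apply: eqP => v /glue_notin. Qed.

Lemma gsum0 Phi tau : gsum fset0 Phi tau = Phi tau.
Proof.
rewrite /gsum (big_pred1 [ffun w : (fset0 : {fset V}) => tau (val w)]).
  by rewrite glue_restrict; congr Phi; apply/funext => v; rewrite inE.
by move=> eta; apply/esym/eqP/ffunP => w; have := valP w; rewrite inE.
Qed.

(** A configuration on the enlarged volume is a spin at [v] together with a configuration on [L];
    [h] and [k] are this bijection. Larger sums are then evaluated by removing one site at a
    time. *)
Lemma gsumU1 L v Phi tau : v \notin L ->
  gsum (v |` L)%fset Phi tau = gsum L (site_sum v Phi) tau.
Proof.
move=> vL.
pose h (p : bool * {ffun L -> bool}) : {ffun (v |` L)%fset -> bool} :=
  [ffun w => glue_config p.2 (fun=> p.1) (val w)].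
pose k (eta : {ffun (v |` L)%fset -> bool}) : bool * {ffun L -> bool} :=
  (glue_config eta (fun=> true) v,
   [ffun w : L => glue_config eta (fun=> true) (val w)]).
have hE p w : w \in (v |` L)%fset ->
    glue_config (h p) (fun=> true) w = glue_config p.2 (fun=> p.1) w.
  by move=> wL; rewrite {1}/h glue_restrict wL.
have hK : cancel h k.
  move=> [b eta]; congr pair; first by rewrite hE ?fset1U1 ?glue_notin.
  apply/ffunP => w; rewrite ffunE hE ?glue_val //.
  by rewrite in_fset1U (valP w) orbT.
have kK : cancel k h.
  move=> eta; apply/ffunP => w; rewrite ffunE /=.
  have := valP w; rewrite in_fset1U.
  case: (boolP (val w \in L)) => wL; last rewrite orbF.
    by move=> _; rewrite glue_restrict wL glue_val.
  by move=> /eqP wv; rewrite glue_notin // -[RHS](glue_val eta (fun=> true)) wv.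
rewrite /gsum (reindex h) /=; last by exists k => p _; [exact: hK|exact: kK].
rewrite -(pair_big xpredT xpredT (fun b eta => Phi (glue_config (h (b, eta)) tau))) /=.
rewrite exchange_big /=; apply: eq_bigr => eta _; rewrite big_bool /=.
have E b : glue_config (h (b, eta)) tau = upd (glue_config eta tau) v b.
  apply/funext => w; rewrite /h glue_restrict in_fset1U /upd /=.
  case: eqVneq => [->|wv] /=; first by rewrite glue_notin.
  by case: ifPn => wL; [exact: glue_in|rewrite glue_notin].
by rewrite !E.
Qed.

Lemma gsumZ L a Phi tau : gsum L (fun s => a * Phi s) tau = a * gsum L Phi tau.
Proof. by rewrite /gsum mulr_sumr. Qed.

Lemma gsum_ge0 L Phi tau : (forall s, 0 <= Phi s) -> 0 <= gsum L Phi tau.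
Proof. by move=> P0; apply: sumr_ge0. Qed.

Lemma gsum_gt0 L Phi tau : (forall s, 0 < Phi s) -> 0 < gsum L Phi tau.
Proof.
move=> P0; rewrite /gsum (bigD1 [ffun=> true]) //=.
by apply: ltr_pwDl => //; apply: sumr_ge0 => eta _; exact: ltW.
Qed.

Lemma ler_gsum L Phi Psi tau :
  (forall s, Phi s <= Psi s) -> gsum L Phi tau <= gsum L Psi tau.
Proof. by move=> PP; apply: ler_sum. Qed.

Lemma gsum_boundary L Phi tau tau' :
  (forall s s', (forall v, v \in L -> s v = s' v) -> Phi s = Phi s') ->
  gsum L Phi tau = gsum L Phi tau'.
Proof. by move=> locP; apply: eq_bigr => eta _; apply: locP => v; exact: glue_in. Qed.

End SiteSums.

(** * Cylinder events and their probabilities *)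

Section Cylinders.
Variables (R : realType) (V : choiceType).
Implicit Types (L M : {fset V}) (sigma tau zeta : V -> bool).

Definition cyl M zeta : set (spin_space V) :=
  [set sigma | forall v, v \in M -> sigma v = zeta v].

Lemma cyl0 zeta : cyl fset0 zeta = setT.
Proof. by apply/seteqP; split => // sigma _ v; rewrite inE. Qed.

Lemma cyl_site v zeta : cyl [fset v]%fset zeta = [set s | s v = zeta v].
Proof.
apply/seteqP; split => s /=; first by apply; rewrite inE.
by move=> sv w; rewrite inE => /eqP ->.
Qed.

Lemma eq_cyl M zeta zeta' :
  (forall v, v \in M -> zeta v = zeta' v) -> cyl M zeta = cyl M zeta'.
Proof. by move=> zz; apply/seteqP; split => s sM v vM; rewrite sM ?zz. Qed.

Lemma cylU M M' zeta : cyl (M `|` M')%fset zeta = cyl M zeta `&` cyl M' zeta.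
Proof.
apply/seteqP; split => s; last first.
  by move=> [sM sM'] v; rewrite inE => /orP[/sM|/sM'].
by move=> sM; split=> v vM; apply: sM; rewrite inE vM ?orbT.
Qed.

Lemma measurable_spin (v : V) (b : bool) :
  measurable ([set s | s v = b] : set (spin_space V)).
Proof. by apply: sub_sigma_algebra; exists v, b. Qed.

Lemma measurable_cyl M zeta : measurable (cyl M zeta).
Proof.
elim/fset1U_rect: M => [|v M vM IH]; first by rewrite cyl0.
by rewrite cylU; apply: measurableI => //; rewrite cyl_site; exact: measurable_spin.
Qed.

Lemma cylI M M' zeta zeta' :
  cyl M zeta `&` cyl M' zeta' = set0 \/
  exists zeta'', cyl M zeta `&` cyl M' zeta' = cyl (M `|` M')%fset zeta''.
Proof.
have [E|] := eqVneq (cyl M zeta `&` cyl M' zeta') set0; first by left.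
move=> /set0P[s [sM sM']]; right; exists s; rewrite cylU; congr (_ `&` _).
  by apply: eq_cyl => v /sM.
by apply: eq_cyl => v /sM'.
Qed.

Lemma cyl_split M v zeta :
  cyl M zeta = cyl (v |` M)%fset (upd zeta v true) `|`
               cyl (v |` M)%fset (upd zeta v false) \/ v \in M.
Proof.
have [vM|vM] := boolP (v \in M); [by right|left].
have E b : cyl (v |` M)%fset (upd zeta v b) =
    [set s | s v = b] `&` cyl M zeta.
  rewrite cylU cyl_site upd_same; congr (_ `&` _).
  by apply: eq_cyl => w wM; rewrite upd_other //; apply: contraNneq vM => <-.
rewrite !E -setIUl -[LHS]setTI; congr (_ `&` _).
by apply/seteqP; split => // s _; case sv : (s v); [left|right].
Qed.

Lemma prob_cyl_split (P : probability (spin_space V) R) M v zeta :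
  v \notin M ->
  fine (P (cyl M zeta)) =
  site_sum v (fun s => fine (P (cyl (v |` M)%fset s))) zeta.
Proof.
move=> vM; case: (cyl_split M v zeta) => [->|]; last by rewrite (negbTE vM).
rewrite measureU ?fineD ?fin_num_measure //; try exact: measurable_cyl.
apply/seteqP; split => // s [/(_ v) + /(_ v)].
by rewrite !inE eqxx !upd_same => -> // /(_ isT).
Qed.

(** Revealing the sites of [L] one by one splits the cylinder over [M] into disjoint pieces. *)
Lemma prob_cyl_marginal (P : probability (spin_space V) R) L M zeta :
  [disjoint L & M]%fset ->
  fine (P (cyl M zeta)) =
  gsum L (fun s => fine (P (cyl (L `|` M)%fset s))) zeta.
Proof.
elim/fset1U_rect: L => [|v L vL IH] dLM; first by rewrite gsum0 fset0U.
have vM : v \notin M by move/fdisjointP: dLM; apply; rewrite fset1U1.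
rewrite gsumU1 // IH; last first.
  by apply/fdisjointP => w wL; move/fdisjointP: dLM; apply; rewrite in_fset1U wL orbT.
apply: eq_gsum => s _; rewrite (@prob_cyl_split _ _ v); last by rewrite inE negb_or vL.
by rewrite /site_sum fsetUA.
Qed.

(** Two cylinders meet in a cylinder or not at all, so the cylinders with the empty set added form a
    pi-system, and it generates the product sigma-algebra. *)
Lemma eq_prob_cyl (P Q : probability (spin_space V) R) :
  (forall M zeta, P (cyl M zeta) = Q (cyl M zeta)) ->
  forall A : set (spin_space V), measurable A -> P A = Q A.
Proof.
move=> PQ; pose G : set (set (spin_space V)) :=
  [set A | A = set0 \/ exists M zeta, A = cyl M zeta].
have Gm : G `<=` measurable.
  by move=> A [->|[M [zeta ->]]]; [exact: measurable0|exact: measurable_cyl].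
apply: (@measure_unique _ _ _ G (fun=> setT)).
- apply/seteqP; split.
    apply: smallest_sub; first exact: smallest_sigma_algebra.
    move=> C [v [b ->]]; apply: sub_sigma_algebra; right.
    by exists [fset v]%fset, (fun=> b); rewrite cyl_site.
  by apply: smallest_sub => //; exact: sigma_algebra_measurable.
- move=> A B [->|[M [z ->]]]; first by move=> _; left; rewrite set0I.
  move=> [->|[M' [z' ->]]]; first by left; rewrite setI0.
  case: (cylI M M' z z') => [->|[z'' ->]]; [by left|right].
  by exists (M `|` M')%fset, z''.
- by move=> _; right; exists fset0, (fun=> true); rewrite cyl0.
- by apply/seteqP; split => // s _; exists 0%N.
- by move=> A [->|[M [z ->]]]; [rewrite !measure0|exact: PQ].
- by move=> n; apply: le_lt_trans (probability_le1 P measurableT) (ltry 1).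
Qed.

(** Any cylinder is a finite disjoint union of cylinders over some larger [L n]. *)
Lemma eq_prob_exhaustion (P Q : probability (spin_space V) R)
    (L : nat -> {fset V}) :
  (forall M : {fset V}, exists n, (M `<=` L n)%fset) ->
  (forall n zeta, P (cyl (L n) zeta) = Q (cyl (L n) zeta)) ->
  forall A : set (spin_space V), measurable A -> P A = Q A.
Proof.
move=> Lex PQ; apply: eq_prob_cyl => M zeta.
have [n Mn] := Lex M.
have E (P' : probability (spin_space V) R) :
    fine (P' (cyl M zeta)) = gsum (L n `\` M)%fset
      (fun s => fine (P' (cyl (L n) s))) zeta.
  rewrite (@prob_cyl_marginal _ (L n `\` M)%fset); last first.
    by apply/fdisjointP => v; rewrite inE => /andP[].
  rewrite (_ : (L n `\` M `|` M)%fset = L n) //; apply/fsetP => v; rewrite !inE.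
  by case: (boolP (v \in M)) => [/(fsubsetP Mn) ->|_] //; rewrite orbF.
rewrite -[LHS]fineK ?fin_num_measure //; last exact: measurable_cyl.
rewrite -[RHS]fineK ?fin_num_measure //; last exact: measurable_cyl.
by rewrite !E; congr EFin; apply: eq_gsum => s _; rewrite PQ.
Qed.

End Cylinders.

(** * Measures from consistent finite-volume laws *)

Section Exhaustion.
Variables (V : choiceType) (code : V -> nat).
Hypothesis code_inj : injective code.

(** A code need not be attained, since [word_code] also numbers words that are not reduced; hence
    the option. At an unattained code neither [exhaust] nor the law [q] changes. *)
Definition code_inv (n : nat) : option V :=
  if pselect (exists v, code v = n) is left h then Some (projT1 (cid h))
  else None.

Lemma code_invP n v : code_inv n = Some v <-> code v = n.
Proof.
rewrite /code_inv; case: pselect => [h|h]; last by split=> // vn; case: h; exists v.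
by case: cid => w wn /=; split=> [[<-] //|vn]; congr Some; apply: code_inj; rewrite wn.
Qed.

Fixpoint exhaust (n : nat) : {fset V} :=
  if n is m.+1 then
    (if code_inv m is Some v then v |` exhaust m else exhaust m)%fset
  else fset0.

Lemma in_exhaust n v : (v \in exhaust n) = (code v < n)%N.
Proof.
elim: n => [|n IH] /=; first by rewrite inE.
rewrite ltnS leq_eqVlt -IH; case E : (code_inv n) => [w|].
  move/code_invP: E => <-; rewrite in_fset1U; congr orb.
  by apply/eqP/eqP => [->|/code_inj].
by case: eqP => //= /code_invP; rewrite E.
Qed.

Lemma exhaust_mono m n : (m <= n)%N -> (exhaust m `<=` exhaust n)%fset.
Proof. by move=> mn; apply/fsubsetP => v; rewrite !in_exhaust => /leq_trans; apply. Qed.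

Lemma exhaust_cofinal (M : {fset V}) : exists n, (M `<=` exhaust n)%fset.
Proof.
exists (\max_(v <- M) (code v).+1)%N; apply/fsubsetP => v vM.
rewrite in_exhaust; exact: (@leq_bigmax_seq _ _ xpredT (fun v => (code v).+1)).
Qed.

Lemma exhaustS n v : code_inv n = Some v -> exhaust n.+1 = (v |` exhaust n)%fset.
Proof. by move=> /= ->. Qed.

Lemma code_inv_notin n v : code_inv n = Some v -> v \notin exhaust n.
Proof. by move/code_invP => <-; rewrite in_exhaust ltnn. Qed.

Variable R : realType.
Variable q : nat -> (V -> bool) -> R.
Hypothesis q0 : forall zeta, q 0 zeta = 1.
Hypothesis q_ge0 : forall n zeta, 0 <= q n zeta.
Hypothesis q_none : forall n zeta, code_inv n = None -> q n.+1 zeta = q n zeta.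
Hypothesis q_some : forall n v zeta, code_inv n = Some v ->
  site_sum v (q n.+1) zeta = q n zeta.
Hypothesis q_local : forall n zeta zeta',
  (forall v, v \in exhaust n -> zeta v = zeta' v) -> q n zeta = q n zeta'.

(* The sites are revealed in the order of their codes, and the cylinder of [zeta]
   over the first [n] codes is realised as a half-open subinterval [slot n zeta]
   of [0, 1) of length [q n zeta]; the law is the image of Lebesgue measure. *)
Fixpoint left_end n zeta : R :=
  if n is m.+1 then
    if code_inv m is Some v then
      if zeta v then left_end m zeta + q m.+1 (upd zeta v false)
      else left_end m zeta
    else left_end m zeta
  else 0.

Definition slot n zeta : set R :=
  `[left_end n zeta, left_end n zeta + q n zeta[%classic.

(** Inverts the subdivision: the spin at each revealed site records on which side of the cut [x]
    lies, so that a point of [0, 1) stays in the slot of its own sample. *)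
Fixpoint sample n (x : R) : V -> bool :=
  if n is m.+1 then
    if code_inv m is Some v then
      upd (sample m x) v
        (left_end m (sample m x) + q m.+1 (upd (sample m x) v false) <= x)
    else sample m x
  else xpred0.

Definition sample_lim (x : R) : spin_space V := fun v => sample (code v).+1 x v.

Lemma left_end_local n zeta zeta' :
  (forall v, v \in exhaust n -> zeta v = zeta' v) ->
  left_end n zeta = left_end n zeta'.
Proof.
elim: n => [//|n IH]; case E : (code_inv n) => [w|]; rewrite /= E // => zz.
rewrite zz ?fset1U1 //.
have -> : left_end n zeta = left_end n zeta'.
  by apply: IH => v vn; apply: zz; rewrite in_fset1U vn orbT.
rewrite (@q_local _ (upd zeta w false) (upd zeta' w false)) // => v.
by rewrite (exhaustS E) /upd; case: eqP => // _; exact: zz.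
Qed.

Lemma slot_local n zeta zeta' :
  (forall v, v \in exhaust n -> zeta v = zeta' v) -> slot n zeta = slot n zeta'.
Proof. by move=> zz; rewrite /slot (left_end_local zz) (q_local zz). Qed.

Lemma slot_none n zeta : code_inv n = None -> slot n.+1 zeta = slot n zeta.
Proof. by move=> E; rewrite /slot /= E q_none. Qed.

Lemma left_end_upd n v b zeta : v \notin exhaust n ->
  left_end n (upd zeta v b) = left_end n zeta.
Proof.
move=> vn; apply: left_end_local => w wn; rewrite upd_other //.
by apply: contraNneq vn => <-.
Qed.

Lemma upd_upd sigma (v : V) b b' : upd (upd sigma v b) v b' = upd sigma v b'.
Proof. by apply/funext => w; rewrite /upd; case: eqP. Qed.

(** Spin [false] takes the left piece of the slot; by the consistency [q_some] the remaining right
    piece has exactly the length assigned to spin [true]. *)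
Lemma slot_true n v zeta x : code_inv n = Some v ->
  slot n.+1 (upd zeta v true) x <->
  slot n zeta x /\ left_end n zeta + q n.+1 (upd zeta v false) <= x.
Proof.
move=> E; have vn := code_inv_notin E.
rewrite /slot /= !in_itv /= E upd_same upd_upd left_end_upd //.
rewrite -(q_some zeta E) /site_sum.
have := q_ge0 n.+1 (upd zeta v false).
set a := q _ _; set b := q _ _; set l := left_end _ _ => a0.
split=> [/andP[? ?]|[/andP[? ?] ?]]; last by apply/andP; split => //; lra.
by split=> //; apply/andP; split; lra.
Qed.

Lemma slot_false n v zeta x : code_inv n = Some v ->
  slot n.+1 (upd zeta v false) x <->
  slot n zeta x /\ x < left_end n zeta + q n.+1 (upd zeta v false).
Proof.
move=> E; have vn := code_inv_notin E.
rewrite /slot /= !in_itv /= E upd_same left_end_upd //.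
rewrite -(q_some zeta E) /site_sum.
have := q_ge0 n.+1 (upd zeta v true).
set a := q _ _; set b := q _ _; set l := left_end _ _ => a0.
split=> [/andP[? ?]|[/andP[? ?] ?]]; last by apply/andP; split => //; lra.
by split=> //; apply/andP; split; lra.
Qed.

Lemma slot0 zeta : slot 0 zeta = `[0, 1[%classic.
Proof. by rewrite /slot /= add0r q0. Qed.

Lemma slotS_sub n zeta : slot n.+1 zeta `<=` slot n zeta.
Proof.
case E : (code_inv n) => [v|]; last by rewrite slot_none.
move=> x; rewrite -{1}(upd_id zeta v).
by case: (zeta v) => [/(slot_true _ _ E)|/(slot_false _ _ E)] [].
Qed.

Lemma slot_sub n zeta : slot n zeta `<=` `[0, 1[%classic.
Proof.
elim: n => [|n IH]; first by rewrite slot0.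
by apply: subset_trans IH; exact: slotS_sub.
Qed.

Lemma slot_sample n x : `[0, 1[%classic x -> slot n (sample n x) x.
Proof.
move=> x01; elim: n => [|n IH]; first by rewrite slot0.
case E : (code_inv n) => [v|]; last by rewrite slot_none //= E.
rewrite /= E; case: leP => h; first exact/(slot_true _ _ E).
exact/(slot_false _ _ E).
Qed.

Lemma slot_eq n zeta zeta' x : slot n zeta x -> slot n zeta' x ->
  forall v, v \in exhaust n -> zeta v = zeta' v.
Proof.
elim: n => [|n IH] s s' v; first by rewrite inE.
have zz := IH (slotS_sub s) (slotS_sub s').
case E : (code_inv n) => [w|]; last by rewrite /= E; exact: zz.
rewrite (exhaustS E) in_fset1U => /predU1P[->|]; last exact: zz.
have qE b : q n.+1 (upd zeta w b) = q n.+1 (upd zeta' w b).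
  apply: q_local => u; rewrite (exhaustS E) in_fset1U /upd.
  by case: eqP => //= _; exact: zz.
move: s s'; rewrite -{1}(upd_id zeta w) -{1}(upd_id zeta' w).
case: (zeta w); case: (zeta' w) => //.
- move=> /(slot_true _ _ E)[_ h] /(slot_false _ _ E)[_]; move: h.
  by rewrite (left_end_local zz) qE; case: leP.
- move=> /(slot_false _ _ E)[_ h] /(slot_true _ _ E)[_]; move: h.
  by rewrite (left_end_local zz) qE; case: leP.
Qed.

Lemma sample_stable n x v : v \in exhaust n -> sample n x v = sample_lim x v.
Proof.
rewrite in_exhaust => vn; rewrite /sample_lim.
elim: n vn => [//|n IH]; rewrite ltnS leq_eqVlt => /predU1P[->//|vn].
rewrite -IH //=; case E : (code_inv n) => [w|//].
by rewrite upd_other //; move: vn; move/code_invP: E => <-; apply: contraTneq => ->; rewrite ltnn.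
Qed.

(** The slots of the configurations on [exhaust n] partition [0, 1): each point lies in the slot of
    its sample and, by [slot_eq], in no other. *)
Lemma cyl_sample_lim n zeta :
  `[0, 1[%classic `&` sample_lim @^-1` cyl (exhaust n) zeta = slot n zeta.
Proof.
apply/seteqP; split=> x.
  move=> [x01 xz]; rewrite -(@slot_local _ (sample n x)); first exact: slot_sample.
  by move=> v vn; rewrite sample_stable // xz.
move=> xz; have x01 := slot_sub xz; split=> // v vn.
by rewrite -(sample_stable x vn); apply: (slot_eq (slot_sample n x01) xz).
Qed.

Lemma measurable_sample_lim :
  measurable_fun [set: measurableTypeR R] (sample_lim : measurableTypeR R -> _).
Proof.
pose K M zeta := sample_lim @^-1` cyl M zeta : set (measurableTypeR R).
have mK n zeta : measurable (K (exhaust n) zeta).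
  elim: n zeta => [|n IH] zeta; first by rewrite /K cyl0 preimage_setT; exact: measurableT.
  case E : (code_inv n) => [v|]; last by have := IH zeta; rewrite /= E.
  have vn := code_inv_notin E.
  pose t := left_end n zeta + q n.+1 (upd zeta v false).
  (* On the cylinder over [exhaust n] the cut [t] is constant, so the condition on the new spin
     becomes a half-line. *)
  have -> : K (exhaust n.+1) zeta = K (exhaust n) zeta `&`
      (if zeta v then [set` `[t, +oo[] else [set` `]-oo, t[]).
    rewrite /K (exhaustS E) cylU cyl_site setIC preimage_setI.
    apply/seteqP; split => x [xz]; rewrite /= => xv; split => //.
      have zz w : w \in exhaust n -> sample n x w = zeta w.
        by move=> wn; rewrite sample_stable // xz.
      move: xv; rewrite -(@sample_stable n.+1); last by rewrite (exhaustS E) fset1U1.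
      rewrite /= E upd_same (left_end_local zz) => <-.
      rewrite (_ : q _ _ = q n.+1 (upd zeta v false)); last first.
        by apply: q_local => w; rewrite (exhaustS E) in_fset1U /upd; case: eqP => //= _ /zz.
      by rewrite -/t; case: leP => h; rewrite /= in_itv /= ?andbT.
    have zz w : w \in exhaust n -> sample n x w = zeta w.
      by move=> wn; rewrite sample_stable // xz.
    rewrite -(@sample_stable n.+1); last by rewrite (exhaustS E) fset1U1.
    rewrite /= E upd_same (left_end_local zz).
    rewrite (_ : q _ _ = q n.+1 (upd zeta v false)); last first.
      by apply: q_local => w; rewrite (exhaustS E) in_fset1U /upd; case: eqP => //= _ /zz.
    rewrite -/t; move: xv; case: (zeta v); rewrite /= in_itv /= ?andbT; first by move=> ->.
    by rewrite ltNge => /negbTE.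
  by apply: measurableI => //; case: (zeta v); exact: measurable_itv.
have mK2 M zeta : measurable (K M zeta).
  have [n Mn] := exhaust_cofinal M.
  (* A cylinder is the union of two cylinders over one more site; the induction is on the sites [L]
     still missing from [exhaust n]. *)
  have : forall (L M' : {fset V}) zeta', [disjoint L & M']%fset ->
      (L `|` M' = exhaust n)%fset -> measurable (K M' zeta').
    move=> L; elim/fset1U_rect: L => [|v L vL IH] M' zeta' dLM LM.
      by move: LM; rewrite fset0U => ->.
    case: (cyl_split M' v zeta') => [E|vM]; last first.
      by move/fdisjointP: dLM => /(_ v); rewrite fset1U1 vM => /(_ isT).
    have dLM' : [disjoint L & v |` M']%fset.
      apply/fdisjointP => w wL; rewrite in_fset1U negb_or.
      rewrite (contraNneq _ vL) => [|<-//] /=.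
      by move/fdisjointP: dLM; apply; rewrite in_fset1U wL orbT.
    have LM' : (L `|` (v |` M') = exhaust n)%fset by rewrite fsetUCA fsetUA.
    by rewrite /K E preimage_setU; apply: measurableU; exact: IH.
  apply; first by apply/(@fdisjointP _ (exhaust n `\` M)%fset) => v; rewrite inE => /andP[].
  apply/fsetP => v; rewrite !inE.
  by case: (boolP (v \in M)) => [/(fsubsetP Mn) ->|_] //; rewrite orbF.
apply: (@measurability _ _ (measurableTypeR R) (spin_space V) setT _ (@spin_cylinders V)) => //.
move=> _ [_ [v [b ->]] <-]; rewrite setTI.
by have := mK2 [fset v]%fset (fun=> b); rewrite /K cyl_site.
Qed.

Definition sample_law (A : set (spin_space V)) : \bar R :=
  mrestr (@lebesgue_measure R) (measurable_itv `[0, 1[) (sample_lim @^-1` A).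

Let sample_law0 : sample_law set0 = 0%E.
Proof. by rewrite /sample_law preimage_set0 measure0. Qed.

Let sample_law_ge0 A : (0 <= sample_law A)%E.
Proof. exact: measure_ge0. Qed.

Let sample_law_sigma_additive : semi_sigma_additive sample_law.
Proof.
have mX A : measurable A -> measurable (sample_lim @^-1` A : set (measurableTypeR R)).
  by move=> mA; rewrite -[X in measurable X]setTI; exact: measurable_sample_lim.
move=> F mF tF mUF; rewrite /sample_law preimage_bigcup.
apply: measure_semi_sigma_additive.
- by move=> n; exact: mX.
- apply/trivIsetP => /= i j _ _ ij; rewrite -preimage_setI.
  by move/trivIsetP : tF => /(_ _ _ _ _ ij) ->//; rewrite preimage_set0.
- by rewrite -preimage_bigcup; exact: mX.
Qed.

HB.instance Definition _ := isMeasure.Build _ _ _ sample_law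
  sample_law0 sample_law_ge0 sample_law_sigma_additive.

Let sample_law_setT : sample_law setT = 1%E.
Proof.
rewrite /sample_law preimage_setT /mrestr setTI.
by rewrite (@lebesgue_measure_itv R `[0, 1[) /= lte_fin ltr01 sube0.
Qed.

HB.instance Definition _ := Measure_isProbability.Build _ _ _
  sample_law sample_law_setT.

Lemma exists_prob_exhaustion :
  exists P : probability (spin_space V) R,
    forall n zeta, P (cyl (exhaust n) zeta) = (q n zeta)%:E.
Proof.
exists sample_law => n zeta.
rewrite /= /sample_law /mrestr setIC cyl_sample_lim /slot.
rewrite (@lebesgue_measure_itv R) /= lte_fin ltrDl.
case: ifPn => [_|]; first by rewrite -EFinD addrAC subrr add0r.
(* A slot without positive length is empty, and then [q n zeta] is 0. *)
by rewrite -leNgt => q0'; congr EFin; apply/eqP; rewrite eq_le q0' q_ge0.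
Qed.

End Exhaustion.

(** * The regular tree *)

Section Tree.
Variable d : nat.
Notation V := (tree_vertex d).
Implicit Types u v w : V.

Definition origin : V := exist _ [::] isT.

Lemma reduced_behead (s : seq 'I_d) : reduced s -> reduced (behead s).
Proof. by case: s => //= i s; exact: path_sorted. Qed.

Definition parent u : V := exist _ (behead (val u)) (reduced_behead (valP u)).

(** Only the first letter of [u] fails this test: it cancels and leads to the parent. At the origin
    every letter passes. *)
Definition is_child (i : 'I_d) u : bool := ohead (val u) != Some i.

(* Injective, and the parent of a vertex has a smaller code, so that the sets
   [exhaust n] are subtrees. *)
Fixpoint word_code (s : seq 'I_d) : nat :=
  if s is i :: s' then (word_code s' * d + i).+1 else 0.

Definition vertex_code u : nat := word_code (val u).

Lemma word_code_inj : injective word_code.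
Proof.
elim=> [|i s IH] [|j t] //= [E].
have := congr1 (modn^~ d) E; have := congr1 (divn^~ d) E.
have d0 : (0 < d)%N by exact: leq_ltn_trans (leq0n i) (ltn_ord i).
rewrite /= !divnMDl // !modnMDl !modn_small ?divn_small ?addn0 //.
by move=> /IH -> /val_inj ->.
Qed.

Lemma vertex_code_inj : injective vertex_code.
Proof. by move=> u v /word_code_inj /val_inj. Qed.

Lemma vertex_code_parent u : u != origin -> (vertex_code (parent u) < vertex_code u)%N.
Proof.
rewrite /vertex_code -val_eqE /=; case: (val u) => [//|i s] _ /=.
have d0 : (0 < d)%N by exact: leq_ltn_trans (leq0n i) (ltn_ord i).
by rewrite ltnS (leq_trans _ (leq_addr _ _)) // leq_pmulr.
Qed.

(** Hence the first [d.+1 ^ m] codes cover the ball of radius [m] around the origin. *)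
Lemma vertex_code_lt u : (vertex_code u < d.+1 ^ size (val u))%N.
Proof.
rewrite /vertex_code; elim: (val u) => [//|i s IH] /=.
have X0 : (0 < d.+1 ^ size s)%N by rewrite expn_gt0.
rewrite expnS mulSn -add1n leq_add //.
apply: leq_trans (_ : (word_code s).+1 * d <= _)%N; last by rewrite mulnC leq_mul2l IH orbT.
by rewrite mulSn -addnS addnC leq_add2r.
Qed.

Lemma size_parent u : size (val (parent u)) = (size (val u)).-1.
Proof. by rewrite /= size_behead. Qed.

Lemma step_child i u : is_child i u -> val (tree_step i u) = i :: val u.
Proof.
rewrite /is_child /=; case: (val u) => [//|j s] /=.
by case: (eqVneq i j) => [->|//]; rewrite eqxx.
Qed.

Lemma step_not_child i u : ~~ is_child i u -> u != origin /\ tree_step i u = parent u.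
Proof.
case: u => -[//|j s] us; rewrite /is_child -val_eqE negbK /= => /eqP[E].
by split=> //; apply/val_inj; rewrite /= E eqxx.
Qed.

Lemma step_neq_origin i u : is_child i u -> tree_step i u != origin.
Proof. by move=> iu; rewrite -val_eqE step_child. Qed.

Lemma parent_step i u : is_child i u -> parent (tree_step i u) = u.
Proof. by move=> iu; apply/val_inj; move: (step_child iu) => /= ->. Qed.

Lemma child_of_parent w : w != origin ->
  exists2 i, is_child i (parent w) & tree_step i (parent w) = w.
Proof.
case: w => -[//|i s] rs _.
have ic : is_child i (parent (exist _ (i :: s) rs)).
  by move: rs; rewrite /is_child /reduced /=; case: s => [//|j s] /= /andP[]; rewrite eq_sym.
by exists i => //; apply/val_inj; move: (step_child ic) => /= ->.
Qed.

Lemma nbrE u w : (w \in tree_nbr u) =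
  (u != origin) && (w == parent u) || (w != origin) && (u == parent w).
Proof.
apply/tree_nbrE/idP => [[i ->]|/orP[/andP[ur /eqP ->]|/andP[wr /eqP ->]]].
- case: (boolP (is_child i u)) => iu; last first.
    by have [-> ->] := step_not_child iu; rewrite eqxx.
  by rewrite step_neq_origin // parent_step // eqxx orbT.
- have [i _ iE] := child_of_parent ur; exists i.
  by rewrite -{2}iE tree_stepK.
- by have [i _ iE] := child_of_parent wr; exists i.
Qed.

(** If the ends were matched crosswise, each vertex would be the parent of the other and hence the
    strictly shorter word. *)
Lemma edge_inj u w : u != origin -> w != origin ->
  [fset u; parent u]%fset = [fset w; parent w]%fset -> u = w.
Proof.
move=> ur wr E.
have sz x : x != origin -> (size (val (parent x)) < size (val x))%N.
  by rewrite size_parent -val_eqE; case: (val x).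
have : u \in [fset w; parent w]%fset by rewrite -E !inE eqxx.
have : w \in [fset u; parent u]%fset by rewrite E !inE eqxx.
rewrite !inE => /orP[/eqP -> //|/eqP wu] /orP[/eqP -> //|/eqP uw].
have h1 := sz u ur; have h2 := sz w wr; rewrite -wu in h1; rewrite -uw in h2.
by have := ltn_trans h1 h2; rewrite ltnn.
Qed.

Variable R : realType.

(** Each edge is named by its endpoint farther from the origin, and [L'] is a finite set containing
    all the endpoints that occur. *)
Lemma sum_edges (L L' : {fset V}) (f : {fset V} -> R) :
  (L `<=` L')%fset -> (forall u, u \in L -> (tree_nbr u `<=` L')%fset) ->
  \sum_(e <- edges_meeting (@tree_nbr d) L) f e =
  \sum_(w <- L' | (w != origin) && ((w \in L) || (parent w \in L)))
     f [fset w; parent w]%fset.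
Proof.
move=> LL' NL.
have -> : edges_meeting (@tree_nbr d) L = [fset [fset w; parent w]%fset | w in
   [fset w in L' | (w != origin) && ((w \in L) || (parent w \in L))]]%fset.
  apply/fsetP => e; apply/imfset2P/imfsetP => /=.
    move=> [u uL [v vu ->]]; move: (vu); rewrite nbrE.
    move=> /orP[/andP[ur /eqP ->]|/andP[vr /eqP E]].
      by exists u => //; rewrite !inE /= (fsubsetP LL') // ur uL.
    exists v; last by rewrite -E fsetUC.
    by rewrite !inE /= vr -E uL orbT !andbT (fsubsetP (NL u uL)).
  move=> [w]; rewrite !inE /= => /andP[_ /andP[wr /orP[wL|wL]]] ->.
    by exists w => //; exists (parent w) => //; rewrite nbrE wr eqxx.
  by exists (parent w) => //; exists w; rewrite ?nbrE ?wr ?eqxx ?orbT // fsetUC.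
rewrite big_imfset /=; last first.
  by move=> u w; rewrite !inE => /and3P[_ ur _] /and3P[_ wr _]; exact: edge_inj.
by rewrite big_fset.
Qed.

Lemma sum_children (L' : {fset V}) v (g : V -> R) :
  (forall i, is_child i v -> tree_step i v \in L') ->
  \sum_(w <- L' | (w != origin) && (parent w == v)) g w =
  \sum_(i < d | is_child i v) g (tree_step i v).
Proof.
move=> cL; rewrite big_fset_condE.
rewrite (_ : [fset w in L' | _]%fset =
    [fset tree_step i v | i in [pred i | is_child i v]]%fset); last first.
  apply/fsetP => w; apply/idP/imfsetP => [|[i iv ->]].
    rewrite !inE => /and3P[_ wr /eqP <-].
    by have [i ic iE] := child_of_parent wr; exists i; rewrite ?iE.
  by rewrite !inE cL //= step_neq_origin // parent_step //=.
rewrite big_imfset /=; last by move=> i j _ _; exact: tree_step_inj.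
by rewrite big_enum.
Qed.

Lemma count_children v (a : R) : v != origin ->
  \sum_(i < d | is_child i v) a = (d%:R - 1) * a.
Proof.
rewrite -val_eqE /is_child; case: (val v) => [//|j s] _ /=.
rewrite (eq_bigl (predC1 j)); last by move=> i; rewrite /= eq_sym.
rewrite sumr_const cardC1 card_ord -[LHS]mulr_natl.
by case: (d) j => [[]//|n] j; rewrite /= -[n.+1%:R]natr1 addrK.
Qed.

Lemma count_origin_children (a : R) :
  \sum_(i < d | is_child i origin) a = d%:R * a.
Proof.
rewrite sumr_const -[LHS]mulr_natl; congr (_%:R * _).
by rewrite -[RHS]card_ord; apply: eq_card.
Qed.

End Tree.

(** * Summing out leaves *)

Section TreeWeights.
Variables (R : realType) (d : nat) (beta B : R).
Notation V := (tree_vertex d).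
Notation exh := (exhaust (@vertex_code d)).
Implicit Types (L : {fset V}) (sigma tau : V -> bool) (msg : V -> R).

(* This is [atanh (tanh beta * tanh h)]. *)
Definition cavity (h : R) : R :=
  ln ((expR (h + beta) + expR (- h - beta)) /
      (expR (h - beta) + expR (- h + beta))) / 2.

(** Sum over the spin of a leaf with field [h]: the left side is the weight for a parent of spin +1,
    the last factor on the right that for spin -1. Their ratio is the one produced by a field
    [cavity h] acting on the parent. *)
Lemma expR_cavity h :
  expR (h + beta) + expR (- h - beta) =
  expR (cavity h *+ 2) * (expR (h - beta) + expR (- h + beta)).
Proof.
have p x y : 0 < expR x + expR y :> R by rewrite addr_gt0 ?expR_gt0.
rewrite -[cavity h *+ 2]mulr_natr divfK ?pnatr_eq0 //.
by rewrite lnK ?posrE ?divr_gt0 // divfK // gt_eqF.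
Qed.

Definition child_sum msg v : R := \sum_(i < d | is_child i v) msg (tree_step i v).

Definition outer_sum L msg w : R :=
  \sum_(i < d | is_child i w && (tree_step i w \notin L)) msg (tree_step i w).

Definition parent_bond sigma w : R :=
  if w == origin d then 0 else beta * (spin R (sigma w) * spin R (sigma (parent w))).

(* The effective energy on [L] when each child [w] outside [L] of a vertex of [L]
   acts on it through the field [msg w].  With [msg w = beta * sigma w] this is
   the Ising energy with boundary condition [sigma]; with a constant solution
   of the cavity equation it is the energy of a Gibbs measure on the tree. *)
Definition energy L msg sigma : R :=
  \sum_(w <- L) (spin R (sigma w) * (B + outer_sum L msg w) + parent_bond sigma w).

Definition weight L msg sigma : R := expR (energy L msg sigma).

Definition closed_up L : Prop := forall w, w \in L -> w != origin d -> parent w \in L.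

Lemma closed_up_exhaust n : closed_up (exh n).
Proof.
move=> w; rewrite !(in_exhaust (@vertex_code_inj d)) => wn /vertex_code_parent.
by move=> /ltn_trans; apply.
Qed.

Lemma energy_local L msg sigma tau : closed_up L ->
  (forall v, v \in L -> sigma v = tau v) -> energy L msg sigma = energy L msg tau.
Proof.
move=> cL st; rewrite /energy; apply: eq_big_seq => w wL; rewrite st //.
by congr (_ + _); rewrite /parent_bond; case: eqVneq => // wr; rewrite !st ?cL.
Qed.

(** Once [v] is inside the volume, its message disappears from the field of its parent and of no
    other vertex. *)
Lemma outer_sum_add L msg v w : v \notin L ->
  outer_sum L msg w = outer_sum (v |` L)%fset msg w +
    (if (v != origin d) && (w == parent v) then msg v else 0).
Proof.
move=> vL; rewrite /outer_sum (bigID (fun i => tree_step i w == v)) /= addrC.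
congr (_ + _).
  by apply: eq_bigl => i; rewrite in_fset1U negb_or -andbA; congr andb; rewrite andbC.
case: ifPn => [/andP[vr /eqP ->]|vw].
  have [i ic iv] := child_of_parent vr.
  rewrite (big_pred1 i) ?iv // => j /=; apply/andP/eqP => [[_ /eqP E]|->].
    by apply: (@tree_step_inj _ (parent v)); rewrite iv.
  by rewrite ic iv vL.
rewrite big_pred0 // => i; apply: contraNF vw => /andP[/andP[ic _] /eqP <-].
by rewrite step_neq_origin // parent_step /=.
Qed.

Lemma energy_add L msg v sigma : v \notin L -> closed_up L -> closed_up (v |` L)%fset ->
  energy (v |` L)%fset msg sigma =
  spin R (sigma v) * (B + child_sum msg v) + parent_bond sigma v
  - (if v == origin d then 0 else msg v * spin R (sigma (parent v)))
  + energy L msg sigma.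
Proof.
move=> vL cL cL1; rewrite /energy big_fsetU1 //= -!addrA; congr (_ + _).
  congr (_ * (_ + _)); apply: eq_bigl => i; case ic : (is_child i v) => //=.
  rewrite in_fset1U negb_or; apply/andP; split.
    by apply: contraTneq ic => /(congr1 (fun u => size (val u))) E;
      apply/negP => /step_child E'; move: E; rewrite E' /= => /eqP; rewrite gtn_eqF.
  (* A child of [v] in [L] would force its parent [v] into [L]; so [v] is a leaf and all its
     children act on it as messages. *)
  apply: contraNN vL => /cL; rewrite parent_step //; apply; exact: step_neq_origin.
congr (_ + _); apply/eqP; rewrite -subr_eq -sumrB /=; apply/eqP.
rewrite big_seq (eq_bigr (fun w => - (if (v != origin d) && (w == parent v)
    then msg v * spin R (sigma (parent v)) else 0))); last first.
  move=> w wL; rewrite (outer_sum_add msg w vL).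
  by case: ifPn => [/andP[_ /eqP ->]|_]; ring.
rewrite -big_seq sumrN; case: eqVneq => [_|vr] /=; first by rewrite big1_eq.
have pL : parent v \in L.
  have := cL1 v (fset1U1 _ _) vr; rewrite in_fset1U => /predU1P[|//] E.
  have := vertex_code_parent vr; by rewrite E ltnn.
rewrite (big_fsetD1 _ pL) /= eqxx big1_fset ?addr0 // => w.
by rewrite in_fsetD1 => /andP[/negbTE ->].
Qed.

(** The sum over the spin of the leaf [v] is a function of the parent's spin which, by the cavity
    equation, is proportional to the exponential of [msg v] times that spin; this is how [v] acts on
    [L] from outside. At the origin there is no parent and the sum is a constant factor. *)
Lemma site_sum_weight L msg v : v \notin L -> closed_up L -> closed_up (v |` L)%fset ->
  (v != origin d -> msg v = cavity (B + child_sum msg v)) ->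
  exists2 C, 0 < C & forall sigma,
    site_sum v (weight (v |` L)%fset msg) sigma = C * weight L msg sigma.
Proof.
move=> vL cL cL1 msgv.
set h := B + child_sum msg v.
have E sigma b : weight (v |` L)%fset msg (upd sigma v b) =
    expR (spin R b * h + (if v == origin d then 0 else
      (beta * spin R b - msg v) * spin R (sigma (parent v)))) * weight L msg sigma.
  rewrite /weight energy_add // expRD upd_same; congr (_ * _); last first.
    congr expR; apply: energy_local => // w wL; rewrite upd_other //.
    by apply: contraNneq vL => <-.
  congr expR; rewrite -addrA; congr (_ + _); rewrite /parent_bond.
  case: eqVneq => [_|vr]; first by rewrite subr0.
  rewrite upd_same upd_other; first by ring.
  by apply/eqP => pv; have := vertex_code_parent vr; rewrite pv ltnn.
have [vr|vr] := eqVneq v (origin d).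
  exists (expR h + expR (- h)); first by rewrite addr_gt0 ?expR_gt0.
  by move=> sigma; rewrite /site_sum !E vr eqxx /spin !addr0 mul1r mulN1r mulrDl.
exists ((expR (h + beta) + expR (- h - beta)) * expR (- msg v)).
  by rewrite mulr_gt0 ?addr_gt0 ?expR_gt0.
move=> sigma; rewrite /site_sum !E (negbTE vr) -mulrDl; congr (_ * _).
(* The constant is read off from a parent of spin +1; spin -1 yields the same one by
   [expR_cavity]. *)
case: (sigma (parent v)); rewrite /spin.
  by rewrite [RHS]mulrDl -!expRD; congr (expR _ + expR _); ring.
rewrite expR_cavity -(msgv vr) [RHS]mulrAC -expRD [RHS]mulrDr -!expRD.
by congr (expR _ + expR _); ring.
Qed.

(** Vertices outside [exh n] are removed in decreasing order of code, each being a leaf when its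
    turn comes. [C] depends neither on [Psi] nor on [tau], so it cancels in quotients. *)
Lemma peel_down n N msg : (n <= N)%N ->
  (forall v, v \in exh N -> v \notin exh n -> v != origin d ->
    msg v = cavity (B + child_sum msg v)) ->
  exists2 C, 0 < C & forall Psi tau,
    (forall s s', (forall v, v \in exh n -> s v = s' v) -> Psi s = Psi s') ->
    gsum (exh N) (fun s => weight (exh N) msg s * Psi s) tau =
    C * gsum (exh n) (fun s => weight (exh n) msg s * Psi s) tau.
Proof.
move=> nN msgE; elim: N nN msgE => [|N IH] nN msgE.
  by exists 1 => // Psi tau _; move: nN; rewrite leqn0 => /eqP ->; rewrite mul1r.
move: nN; rewrite leq_eqVlt => /predU1P[->|]; first by exists 1 => // *; rewrite mul1r.
rewrite ltnS => nN; have [|C C0 CE] := IH nN.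
  by move=> v vN; apply: msgE; exact: (fsubsetP (exhaust_mono (@vertex_code_inj d) (leqnSn N))).
case E : (code_inv (@vertex_code d) N) => [v|]; last by rewrite /= E; exists C.
have vN : v \notin exh N := code_inv_notin (@vertex_code_inj d) E.
have vn : v \notin exh n.
  by apply: contraNN vN; exact: (fsubsetP (exhaust_mono (@vertex_code_inj d) nN)).
have cl := @closed_up_exhaust N.+1; have eS := exhaustS E.
rewrite eS in cl msgE *.
have [|C' C'0 C'E] := @site_sum_weight (exh N) msg v vN (@closed_up_exhaust N) cl.
  by apply: msgE => //; rewrite fset1U1.
exists (C' * C); first exact: mulr_gt0.
move=> Psi tau PsiE; rewrite gsumU1 // -mulrA -(CE Psi) // -gsumZ.
apply: eq_gsum => s _; rewrite mulrA -C'E /site_sum mulrDl.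
by congr (_ * _ + _ * _); apply: PsiE => w wn; rewrite upd_other //;
  apply: contraNneq vn => <-.
Qed.

(** The volume is closed under parents, so the weight sees no spin outside it and [xpredT] is an
    arbitrary choice. *)
Definition partition_fun n msg : R := gsum (exh n) (weight (exh n) msg) xpredT.

Lemma weight_gt0 L msg sigma : 0 < weight L msg sigma.
Proof. exact: expR_gt0. Qed.

Lemma partition_fun_gt0 n msg : 0 < partition_fun n msg.
Proof. by apply: gsum_gt0 => s; exact: weight_gt0. Qed.

(** A vertex other than the origin has d - 1 children, so the constant message [u] solves the cavity
    equation there and the normalised weights are consistent. *)
Lemma splitting_measure (u : R) : u = cavity (B + (d%:R - 1) * u) ->
  exists P : probability (spin_space V) R, forall n zeta,
    P (cyl (exh n) zeta) =
    (weight (exh n) (fun=> u) zeta / partition_fun n (fun=> u))%:E.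
Proof.
move=> uE.
apply: (exists_prob_exhaustion (@vertex_code_inj d)
  (q := fun n zeta => weight (exh n) (fun=> u) zeta / partition_fun n (fun=> u))).
- move=> zeta; rewrite /partition_fun gsum0 /weight /energy /= !big_seq_fset0.
  by rewrite divff // expR0 oner_eq0.
- by move=> n zeta; rewrite divr_ge0 // ltW ?weight_gt0 ?partition_fun_gt0.
- by move=> n zeta E; rewrite /partition_fun /= E.
- move=> n v zeta E.
  have vn := code_inv_notin (@vertex_code_inj d) E.
  have cl := @closed_up_exhaust n.+1; have eS := exhaustS E; rewrite eS in cl.
  have [|C C0 CE] := @site_sum_weight (exh n) (fun=> u) v vn (@closed_up_exhaust n) cl.
    by move=> vr; rewrite /child_sum count_children.
  rewrite /site_sum -mulrDl /partition_fun eS gsumU1 //.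
  rewrite (eq_gsum (Psi := fun s => C * weight (exh n) (fun=> u) s)); last first.
    by move=> s _; rewrite CE.
  have := CE zeta; rewrite /site_sum => ->.
  by rewrite gsumZ -mulf_div divff ?mul1r // gt_eqF.
- move=> n z z' zz; congr (_ / _); congr expR; apply: energy_local => //.
  exact: closed_up_exhaust.
Qed.

End TreeWeights.

(** * The Gibbs property *)

Section KernelLaw.
Variables (R : realType) (V : choiceType) (N : V -> {fset V}) (beta B : R).
Variables (P : probability (spin_space V) R) (L : {fset V}).
Notation bz := (boltzmann_weight N beta B L).

Lemma boltzmann_weight_gt0 sigma : 0 < bz sigma.
Proof. exact: expR_gt0. Qed.

Lemma measurable_spin_fun (v : V) :
  measurable_fun setT (fun tau : spin_space V => spin R (tau v)).
Proof.
rewrite (_ : (fun _ => _) =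
    (fun tau : spin_space V => 2 * \1_[set s : spin_space V | s v = true] tau - 1)).
  apply: measurable_funB => //; apply: measurable_funM => //.
  by apply: measurable_indic; exact: measurable_spin.
apply/funext => tau; rewrite indicE /spin.
case tv : (tau v); first by rewrite mem_set //=; lra.
by rewrite memNset /= ?tv //; lra.
Qed.

Lemma measurable_glue (eta : {ffun L -> bool}) :
  measurable_fun setT (glue_config eta : spin_space V -> spin_space V).
Proof.
apply: (@measurability _ _ (spin_space V) (spin_space V) setT _ (@spin_cylinders V)) => //.
move=> _ [_ [v [b ->]] <-]; rewrite setTI.
case: (boolP (v \in L)) => vL; last first.
  rewrite (_ : _ @^-1` _ = [set s | s v = b]); first exact: measurable_spin.
  by apply/seteqP; split => s /=; rewrite glue_notin.
have [E|E] := eqVneq (glue_config eta xpredT v) b.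
  rewrite (_ : _ @^-1` _ = setT) //; apply/seteqP; split => // s _ /=.
  by rewrite (glue_in _ _ xpredT).
rewrite (_ : _ @^-1` _ = set0) //; apply/seteqP; split => // s /=.
by rewrite (glue_in _ _ xpredT) //; exact/eqP.
Qed.

Lemma measurable_boltzmann : measurable_fun setT (bz : spin_space V -> R).
Proof.
apply: measurableT_comp => //; apply: measurable_funD; apply: measurable_funM => //.
  apply: measurable_sum => e; apply: measurable_prod => v _.
  exact: measurable_spin_fun.
by apply: measurable_sum => v; exact: measurable_spin_fun.
Qed.

Definition kernel_density (eta : {ffun L -> bool}) (tau : spin_space V) : R :=
  bz (glue_config eta tau) / gsum L bz tau.

Lemma kernel_density_ge0 eta tau : 0 <= kernel_density eta tau.
Proof.
by rewrite divr_ge0 // ?gsum_ge0 // => *; rewrite ltW // boltzmann_weight_gt0.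
Qed.

Lemma measurable_kernel_density eta : measurable_fun setT (kernel_density eta).
Proof.
have mbz (eta' : {ffun L -> bool}) :
    measurable_fun setT (fun tau : spin_space V => bz (glue_config eta' tau)).
  exact: (measurableT_comp measurable_boltzmann (measurable_glue eta')).
(* The inverse of the positive denominator is written as a composition of measurable maps. *)
rewrite (_ : kernel_density eta =
    (fun tau => bz (glue_config eta tau) * expR (- ln (gsum L bz tau)))).
  apply: measurable_funM => //; apply: measurableT_comp => //.
  apply: measurable_funN; apply: measurableT_comp; first exact: measurable_ln.
  by apply: measurable_sum => eta'; exact: mbz.
apply/funext => tau; rewrite /kernel_density expRN lnK //.
by rewrite posrE gsum_gt0 // => s; exact: boltzmann_weight_gt0.
Qed.

Lemma ising_kernelE A tau : ising_kernel N beta B L A tau =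
  \sum_(eta : {ffun L -> bool}) kernel_density eta tau * \1_A (glue_config eta tau).
Proof.
rewrite /ising_kernel mulr_suml; apply: eq_bigr => eta _.
by rewrite mulrAC.
Qed.

Lemma measurable_ising_kernel (A : set (spin_space V)) : measurable A ->
  measurable_fun setT (ising_kernel N beta B L A : spin_space V -> R).
Proof.
move=> mA; rewrite (_ : ising_kernel N beta B L A = fun tau => \sum_(eta : {ffun L -> bool})
    kernel_density eta tau * \1_A (glue_config eta tau)); last first.
  by apply/funext => tau; exact: ising_kernelE.
apply: measurable_sum => eta; apply: measurable_funM.
  exact: measurable_kernel_density.
exact: (measurableT_comp (@measurable_indic _ _ R setT _ mA) (measurable_glue eta)).
Qed.

Lemma ising_kernel_ge0 A tau : 0 <= ising_kernel N beta B L A tau.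
Proof.
by rewrite ising_kernelE; apply: sumr_ge0 => eta _; rewrite mulr_ge0 ?kernel_density_ge0.
Qed.

Lemma ge0_integral_le_cst (f : spin_space V -> R) (a : R) : measurable_fun setT f ->
  (forall tau, 0 <= f tau <= a) -> (\int[P]_tau (f tau)%:E <= a%:E)%E.
Proof.
move=> mf fa; have : (\int[P]_tau (cst a%:E) tau = a%:E)%E.
  by rewrite integral_cst //= probability_setT mule1.
move=> <-; apply: ge0_le_integral => //.
- by move=> tau _; rewrite lee_fin; have /andP[] := fa tau.
- exact/measurable_EFinP.
- by move=> tau _ /=; rewrite lee_fin; have /andP[] := fa tau.
Qed.

Lemma ge0_cst_le_integral (f : spin_space V -> R) (a : R) : measurable_fun setT f ->
  0 <= a -> (forall tau, a <= f tau) -> (a%:E <= \int[P]_tau (f tau)%:E)%E.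
Proof.
move=> mf a0 fa; have : (\int[P]_tau (cst a%:E) tau = a%:E)%E.
  by rewrite integral_cst //= probability_setT mule1.
move=> <-; apply: ge0_le_integral => //.
- exact/measurable_EFinP.
- by move=> tau _ /=; rewrite lee_fin.
Qed.

(** Splitting over the finitely many inner configurations reduces countable additivity to that of
    the integral of a density over preimages. *)
Definition kernel_law (A : set (spin_space V)) : \bar R :=
  (\sum_(eta : {ffun L -> bool})
     \int[P]_(tau in glue_config eta @^-1` A) (kernel_density eta tau)%:E)%E.

Let mglue (eta : {ffun L -> bool}) (A : set (spin_space V)) : measurable A ->
  measurable (glue_config eta @^-1` A : set (spin_space V)).
Proof. by move=> mA; rewrite -[X in measurable X]setTI; exact: measurable_glue. Qed.

Lemma kernel_lawE A : measurable A ->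
  kernel_law A = (\int[P]_tau (ising_kernel N beta B L A tau)%:E)%E.
Proof.
move=> mA; rewrite /kernel_law.
under [RHS]eq_integral do rewrite ising_kernelE -sumEFin.
rewrite ge0_integral_sum //=; last 2 first.
- move=> eta; apply/measurable_EFinP; apply: measurable_funM.
    exact: measurable_kernel_density.
  exact: (measurableT_comp (@measurable_indic _ _ R setT _ mA) (measurable_glue eta)).
- by move=> eta tau _; rewrite lee_fin mulr_ge0 ?kernel_density_ge0.
apply: eq_bigr => eta _; rewrite integral_mkcond; apply: eq_integral => tau _.
rewrite patchE indicE; case: ifPn => h.
  by move: h; rewrite inE /= => h; rewrite mem_set // mulr1.
by move: h; rewrite notin_setE /= => h; rewrite memNset // mulr0.
Qed.

Let kernel_law0 : kernel_law set0 = 0%E.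
Proof. by rewrite /kernel_law big1 // => eta _; rewrite preimage_set0 integral_set0. Qed.

Let part_ge0 (eta : {ffun L -> bool}) (A : set (spin_space V)) :
  (0 <= \int[P]_(tau in glue_config eta @^-1` A) (kernel_density eta tau)%:E)%E.
Proof. by apply: integral_ge0 => tau _; rewrite lee_fin kernel_density_ge0. Qed.

Let kernel_law_ge0 A : (0 <= kernel_law A)%E.
Proof. by apply: sume_ge0 => eta _; exact: part_ge0. Qed.

Let kernel_law_sigma_additive : semi_sigma_additive kernel_law.
Proof.
move=> /= F mF tF mUF; apply: cvg_toP.
  by apply: is_cvg_nneseries => n _ _; exact: kernel_law_ge0.
rewrite /kernel_law nneseries_sum //; apply: eq_bigr => eta _.
rewrite preimage_bigcup ge0_integral_bigcup //.
- by move=> k; exact: mglue.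
- apply: measurable_funTS; apply/measurable_EFinP; exact: measurable_kernel_density.
- by move=> tau _; rewrite lee_fin kernel_density_ge0.
- apply/trivIsetP => /= i j _ _ ij; rewrite -preimage_setI.
  by move/trivIsetP : tF => /(_ _ _ _ _ ij) ->//; rewrite preimage_set0.
Qed.

HB.instance Definition _ := isMeasure.Build _ _ _ kernel_law
  kernel_law0 kernel_law_ge0 kernel_law_sigma_additive.

Let kernel_law_setT : kernel_law setT = 1%E.
Proof.
rewrite kernel_lawE //.
under eq_integral => tau _.
  rewrite (_ : ising_kernel _ _ _ _ _ _ = 1).
    over.
  rewrite /ising_kernel.
  under eq_bigr do rewrite indicE mem_set // mulr1.
  by rewrite divff // gt_eqF // gsum_gt0 // => s; exact: boltzmann_weight_gt0.
by rewrite integral_cst //= probability_setT mule1.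
Qed.

HB.instance Definition _ := Measure_isProbability.Build _ _ _
  kernel_law kernel_law_setT.

Lemma exists_kernel_law : exists Q : probability (spin_space V) R,
  forall A : set (spin_space V), measurable A ->
    Q A = (\int[P]_tau (ising_kernel N beta B L A tau)%:E)%E.
Proof. by exists kernel_law => A mA; rewrite -kernel_lawE. Qed.

(** Only the inner configuration given by [zeta] can land in the cylinder, and only if the boundary
    agrees with [zeta] on the rest of [M]; there the kernel is a constant, the Boltzmann weight
    depending only on spins in [M]. *)
Lemma kernel_law_cyl (M : {fset V}) zeta : (L `<=` M)%fset ->
  (forall s s', (forall v, v \in M -> s v = s' v) -> bz s = bz s') ->
  (\int[P]_tau (ising_kernel N beta B L (cyl M zeta) tau)%:E)%E =
  ((bz zeta / gsum L bz zeta) * fine (P (cyl (M `\` L)%fset zeta)))%:E.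
Proof.
move=> LM loc; set c := _ / _.
transitivity (\int[P]_tau (c * \1_(cyl (M `\` L)%fset zeta) tau)%:E)%E; last first.
  under eq_integral do rewrite EFinM.
  rewrite ge0_integralZl_EFin //=; last 2 first.
  - by apply/measurable_EFinP; apply: measurable_indic; exact: measurable_cyl.
  - by rewrite divr_ge0 // ?gsum_ge0 // => *; rewrite ltW // boltzmann_weight_gt0.
  rewrite integral_indic //; last exact: measurable_cyl.
  by rewrite setIT [RHS]EFinM fineK // fin_num_measure //; exact: measurable_cyl.
apply: eq_integral => tau _; congr EFin; rewrite /ising_kernel [in RHS]indicE.
case: (boolP (tau \in _)) => [|tz]; last first.
  rewrite mulr0 big1 ?mul0r // => eta _; rewrite indicE memNset ?mulr0 //.
  move=> ez; move: tz; rewrite notin_setE; apply => v; rewrite inE => /andP[vL vM].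
  by rewrite -(ez v vM) glue_notin.
rewrite inE mulr1 => tz; congr (_ / _); last first.
  apply: eq_bigr => eta _; apply: loc => v vM.
  case: (boolP (v \in L)) => vL; first exact: glue_in.
  by rewrite !glue_notin // tz // inE vL.
have gE : forall v, v \in M -> glue_config [ffun w : L => zeta (val w)] tau v = zeta v.
  by move=> v vM; rewrite glue_restrict; case: ifPn => // vL; rewrite tz // inE vL.
rewrite (bigD1 [ffun w : L => zeta (val w)]) //= indicE mem_set ?mulr1; last exact: gE.
rewrite big1 ?addr0; first exact: loc.
move=> eta ne; rewrite indicE memNset ?mulr0 // => ez.
move/eqP: ne; apply; apply/ffunP => w; rewrite ffunE -(glue_val eta tau) ez //.
exact: (fsubsetP LM _ (valP w)).
Qed.

End KernelLaw.

(** * Gibbs measures on the tree from fixed messages *)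

Section TreeGibbs.
Variables (R : realType) (d : nat) (beta B : R).
Notation V := (tree_vertex d).
Notation exh := (exhaust (@vertex_code d)).
Notation bz L := (boltzmann_weight (@tree_nbr d) beta B L).
Notation weight := (weight beta B).
Notation cavity := (cavity beta).
Implicit Types (L : {fset V}) (sigma tau : V -> bool) (msg : V -> R).

Definition log_boltzmann L sigma : R :=
  beta * (\sum_(e <- edges_meeting (@tree_nbr d) L) \prod_(v <- e) spin R (sigma v))
  + B * (\sum_(v <- L) spin R (sigma v)).

Lemma parent_neq (w : V) : w != origin d -> parent w != w.
Proof.
by move=> /vertex_code_parent h; apply: contraTneq h => ->; rewrite ltnn.
Qed.

Lemma sum_fset_mem L (L' : {fset V}) (P : pred V) (F : V -> R) : (L `<=` L')%fset ->
  \sum_(w <- L' | (w \in L) && P w) F w = \sum_(w <- L | P w) F w.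
Proof.
move=> LL'; apply: eq_fbig_cond => // w; rewrite !inE /=.
by case wL : (w \in L); rewrite ?andbF //= (fsubsetP LL').
Qed.

(** Each edge is charged to its endpoint farther from the origin, so that this energy can be
    compared with [energy] vertex by vertex. *)
Lemma log_boltzmannE L (L' : {fset V}) sigma :
  (L `<=` L')%fset -> (forall u, u \in L -> (tree_nbr u `<=` L')%fset) ->
  log_boltzmann L sigma = \sum_(w <- L')
    ((if w \in L then B * spin R (sigma w) else 0) +
     (if (w \in L) || (parent w \in L) then parent_bond beta sigma w else 0)).
Proof.
move=> LL' NL; rewrite /log_boltzmann addrC big_split /=; congr (_ + _).
  rewrite -big_mkcond /= mulr_sumr -(sum_fset_mem xpredT _ LL').
  by apply: eq_bigl => w; rewrite andbT.
rewrite (sum_edges _ LL' NL) mulr_sumr big_mkcond /=; apply: eq_bigr => w _.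
rewrite /parent_bond; case: eqVneq => [_|wr] /=; first by rewrite if_same.
case: ifP => // _; rewrite big_fsetU1 /= ?big_seq_fset1 //.
by rewrite inE eq_sym parent_neq.
Qed.

Lemma sum_boundary L (L' : {fset V}) (g : V -> R) :
  (forall u, u \in L -> (tree_nbr u `<=` L')%fset) ->
  \sum_(w <- L') (if [&& w != origin d, w \notin L & parent w \in L] then g w else 0) =
  \sum_(v <- L) \sum_(i < d | is_child i v && (tree_step i v \notin L)) g (tree_step i v).
Proof.
move=> NL; transitivity (\sum_(v <- L) \sum_(w <- L' | (w != origin d) && (parent w == v))
    (if w \notin L then g w else 0)); last first.
  rewrite !big_seq; apply: eq_bigr => v vL; rewrite sum_children ?big_mkcondr //.
  by move=> i _; apply: (fsubsetP (NL v vL)); apply/tree_nbrE; exists i.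
under [RHS]eq_bigr do rewrite big_mkcond /=.
rewrite exchange_big /=; apply: eq_bigr => w _.
case: eqVneq => [_|wr] /=; first by rewrite big1_eq.
case: (boolP (parent w \in L)) => pL; rewrite ?andbT ?andbF.
  by rewrite (big_fsetD1 _ pL) /= eqxx big1_fset ?addr0 // => v;
    rewrite in_fsetD1 eq_sym => /andP[/negbTE ->].
by rewrite big1_fset // => v vL _; case: eqP => // pv; rewrite pv vL in pL.
Qed.

Lemma exists_exhaust_nbr L (n0 : nat) : exists n, [/\ (n0 <= n)%N, (L `<=` exh n)%fset &
  forall u, u \in L -> (tree_nbr u `<=` exh n)%fset].
Proof.
have [n nP] := exhaust_cofinal (@vertex_code_inj d)
  (L `|` [fset w | u in L, w in tree_nbr u])%fset.
have mono := fsubset_trans _ (exhaust_mono (@vertex_code_inj d) (leq_maxr n0 n)).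
exists (maxn n0 n); split; first exact: leq_maxl.
  by apply: mono; apply: fsubset_trans nP; exact: fsubsetUl.
move=> u uL; apply: mono; apply/fsubsetP => w wu; apply: (fsubsetP nP).
by rewrite inE; apply/orP; right; apply/imfset2P; exists u => //; exists w.
Qed.

(** An edge meeting [L] either has its farther endpoint in [L], giving a [parent_bond], or leads
    from [L] to a child outside, giving a term of [outer_sum]. *)
Lemma boltzmann_weightE L sigma :
  bz L sigma = weight L (fun w => beta * spin R (sigma w)) sigma.
Proof.
have [n [_ LL' NL]] := exists_exhaust_nbr L 0.
congr expR; rewrite -/(log_boltzmann L sigma) (log_boltzmannE _ LL' NL) /energy.
rewrite big_split /= -big_mkcond /=.
under [in RHS]eq_bigr do rewrite mulrDr -addrA.
rewrite [RHS]big_split /=; congr (_ + _).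
  rewrite -(sum_fset_mem xpredT _ LL').
  by apply: eq_big => [w|w _]; rewrite ?andbT // mulrC.
rewrite (eq_bigr (fun w => (if w \in L then parent_bond beta sigma w else 0) +
  (if [&& w != origin d, w \notin L & parent w \in L]
   then parent_bond beta sigma w else 0))); last first.
  move=> w _; case: (w \in L); rewrite /= ?andbF /= ?addr0 // add0r.
  by rewrite /parent_bond; case: eqVneq => //= _; rewrite if_same.
rewrite [LHS]big_split [RHS]big_split [RHS]addrC /=; congr (_ + _).
  rewrite -big_mkcond -(sum_fset_mem xpredT _ LL').
  by apply: eq_bigl => w; rewrite andbT.
rewrite sum_boundary //; apply: eq_bigr => v _; rewrite mulr_sumr.
apply: eq_bigr => i /andP[iv _]; rewrite /parent_bond.
by rewrite (negbTE (step_neq_origin iv)) parent_step //; ring.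
Qed.

Lemma boltzmann_local L n : (L `<=` exh n)%fset ->
  (forall u, u \in L -> (tree_nbr u `<=` exh n)%fset) ->
  forall s s', (forall v, v \in exh n -> s v = s' v) -> bz L s = bz L s'.
Proof.
move=> LL' NL s s' ss; congr expR; rewrite -!/(log_boltzmann L _).
rewrite !(log_boltzmannE _ LL' NL); apply: eq_big_seq => w wn.
rewrite ss //; congr (_ + _); case: ifP => // _; rewrite /parent_bond.
by case: eqVneq => // wr; rewrite !ss // (@closed_up_exhaust _ n).
Qed.

(** The two energies differ only in terms whose spins all lie outside [L], where [sigma] and [tau]
    agree: messages act on no vertex of [L], as the neighbours of [L] are in the volume. *)
Lemma weight_boltzmann L n msg sigma tau : (L `<=` exh n)%fset ->
  (forall u, u \in L -> (tree_nbr u `<=` exh n)%fset) ->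
  (forall v, v \notin L -> sigma v = tau v) ->
  weight (exh n) msg sigma * bz L tau = weight (exh n) msg tau * bz L sigma.
Proof.
move=> LL' NL st; rewrite /boltzmann_weight -!/(log_boltzmann L _) -!expRD.
congr expR.
suff : (energy beta B (exh n) msg sigma - log_boltzmann L sigma) -
    (energy beta B (exh n) msg tau - log_boltzmann L tau) = 0 by lra.
rewrite !(log_boltzmannE _ LL' NL) /energy -!sumrB.
apply: big1_seq => w /andP[_ wn].
have oL : w \in L -> outer_sum (exh n) msg w = 0.
  move=> wL; rewrite /outer_sum big_pred0 // => i; apply/negbTE; rewrite negb_and negbK.
  by rewrite (fsubsetP (NL w wL)) ?orbT //; apply/tree_nbrE; exists i.
have [wL|wL] := boolP (w \in L); rewrite /=; first by rewrite oL //; ring.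
rewrite st //; case: (boolP (parent w \in L)) => pL; first by ring.
by rewrite /parent_bond !st //; ring.
Qed.

Lemma exists_ising_gibbs (u : R) : u = cavity (B + (d%:R - 1) * u) ->
  exists2 P : probability (spin_space V) R, is_ising_gibbs (@tree_nbr d) beta B P &
    forall n zeta, P (cyl (exh n) zeta) =
      (weight (exh n) (fun=> u) zeta / @partition_fun R d beta B n (fun=> u))%:E.
Proof.
move=> /splitting_measure[P PE]; exists P => // L A mA.
have [Q QE] := exists_kernel_law (@tree_nbr d) beta B P L.
rewrite -QE //; have [n0 [_ LL' NL]] := exists_exhaust_nbr L 0.
(* Starting at [n0] puts [L] and its neighbours inside every volume considered. *)
apply: (@eq_prob_exhaustion _ _ P Q (fun n => exh (n0 + n))) => // [M|n zeta].
  have [n Mn] := exhaust_cofinal (@vertex_code_inj d) M; exists n.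
  by exact: fsubset_trans Mn (exhaust_mono (@vertex_code_inj d) (leq_addl n0 n)).
set k := (n0 + n)%N.
have mono := fsubset_trans _ (exhaust_mono (@vertex_code_inj d) (leq_addr n n0)).
have Lk : (L `<=` exh k)%fset by exact: mono.
have Nk x : x \in L -> (tree_nbr x `<=` exh k)%fset by move=> /NL; exact: mono.
rewrite QE; last exact: measurable_cyl.
rewrite kernel_law_cyl //; last exact: boltzmann_local.
rewrite PE; congr EFin.
rewrite (@prob_cyl_marginal _ _ P L); last first.
  by apply/fdisjointP => v vL; rewrite inE vL.
rewrite (_ : (L `|` (exh k `\` L))%fset = exh k); last first.
  apply/fsetP => v; rewrite !inE; case: (boolP (v \in L)) => //= vL.
  by rewrite (fsubsetP Lk).
set Z := @partition_fun _ _ _ _ _ _.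
have G0 : gsum L (bz L) zeta != 0.
  by rewrite gt_eqF // gsum_gt0 // => s; exact: boltzmann_weight_gt0.
apply: (mulIf G0); rewrite [RHS]mulrAC divfK //.
have bz0 := lt0r_neq0 (boltzmann_weight_gt0 (@tree_nbr d) beta B L zeta).
(* Among configurations agreeing with [zeta] outside [L], the law [P] of the cylinder is
   proportional to the Boltzmann weight of [L]. *)
rewrite [in RHS](eq_gsum (Psi := fun s =>
  (weight (exh k) (fun=> u) zeta / Z / bz L zeta) * bz L s));
  last first.
  move=> s sz; rewrite PE /=; apply: (mulIf bz0).
  rewrite mulrAC (weight_boltzmann (fun=> u) Lk Nk sz).
  by rewrite [RHS]mulrAC divfK ?lt0r_neq0 ?boltzmann_weight_gt0 // mulrAC.
rewrite gsumZ [RHS]mulrA [bz L zeta * _]mulrC divfK ?lt0r_neq0 ?boltzmann_weight_gt0 //.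
Qed.

End TreeGibbs.

(** * Comparison of Gibbs measures *)

Section TreeUniqueness.
Variables (R : realType) (d : nat) (beta B : R).
Notation V := (tree_vertex d).
Notation exh := (exhaust (@vertex_code d)).
Notation bz L := (boltzmann_weight (@tree_nbr d) beta B L).
Notation weight := (weight beta B).
Notation cavity := (cavity beta).
Implicit Types (L : {fset V}) (sigma tau : V -> bool) (msg : V -> R).

Hypothesis d_gt0 : (0 < d)%N.
Hypothesis cavity_mono : {homo cavity : x y / x <= y}.
Hypothesis cavity_bound : forall h, `|cavity h| <= beta.

Definition recursion (l : R) : R := cavity (B + (d%:R - 1) * l).

Let beta0 : 0 <= beta. Proof. exact: le_trans (cavity_bound 0). Qed.

Lemma recursion_mono : {homo recursion : x y / x <= y}.
Proof.
move=> x y xy; apply: cavity_mono; rewrite lerD2l ler_wpM2l //.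
by rewrite subr_ge0 ler1n.
Qed.

Lemma iter_recursion_le j : iter j recursion (- beta) <= iter j recursion beta.
Proof.
elim: j => [|j IH]; last by rewrite !iterS recursion_mono.
by move: beta0 => /=; lra.
Qed.

(* The messages after summing out [exhaust N]; [k] is a recursion bound, which is
   immaterial once [N <= k + vertex_code w]. *)
Fixpoint boundary_msg (k N : nat) tau (w : V) : R :=
  if k is k'.+1 then
    if w \in exh N then cavity (B + child_sum (boundary_msg k' N tau) w)
    else beta * spin R (tau w)
  else beta * spin R (tau w).

Lemma vertex_code_step (i : 'I_d) (w : V) : is_child i w ->
  (vertex_code w < vertex_code (tree_step i w))%N.
Proof.
move=> iw; rewrite -{1}(parent_step iw).
by apply: vertex_code_parent; exact: step_neq_origin.
Qed.

(** Codes increase from a vertex to its children, so [k] levels below [w] they have reached [N] and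
    the recursion has left [exh N]. *)
Lemma boundary_msgS k N tau w : (N <= k + vertex_code w)%N ->
  boundary_msg k.+1 N tau w = boundary_msg k N tau w.
Proof.
elim: k w => [|k IH] w kw.
  by rewrite /= (in_exhaust (@vertex_code_inj d)) ltnNge kw.
rewrite [LHS]/= [RHS]/=; case: ifP => // _; congr (cavity (B + _)).
apply: eq_bigr => i iw; apply: IH; apply: leq_trans kw _.
by rewrite addSnnS leq_add2l vertex_code_step.
Qed.

Lemma boundary_msgE N tau w : w \in exh N ->
  boundary_msg N N tau w = cavity (B + child_sum (boundary_msg N N tau) w).
Proof.
by move=> wN; rewrite -boundary_msgS ?leq_addr //= wN.
Qed.

Lemma boundary_msg_out N k tau w : w \notin exh N ->
  boundary_msg k N tau w = beta * spin R (tau w).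
Proof. by case: k => //= k /negbTE ->. Qed.

Lemma boundary_msg_bound N k tau w : `|boundary_msg k N tau w| <= beta.
Proof.
have b : `|beta * spin R (tau w)| <= beta.
  by rewrite normrM ger0_norm // /spin; case: (tau w); rewrite ?normrN normr1 mulr1.
by case: k => //= k; case: ifP.
Qed.

(** The volume contains [j] full levels starting at [w], so its message comes from [j] monotone
    steps applied to messages in [-beta, beta]. Away from the origin there are d - 1 children, as in
    [recursion]. *)
Lemma boundary_msg_iter N m tau : (forall v : V, (size (val v) < m)%N -> v \in exh N) ->
  forall j k w, w != origin d -> (size (val w) + j <= m)%N -> (N <= k + vertex_code w)%N ->
  iter j recursion (- beta) <= boundary_msg k N tau w <= iter j recursion beta.
Proof.
move=> ballN; elim=> [|j IH] k w wr wm kw.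
  by rewrite /= -ler_norml boundary_msg_bound.
have wN : w \in exh N by apply: ballN; apply: leq_trans wm; rewrite addnS ltnS leq_addr.
case: k kw => [|k] kw.
  by move: wN; rewrite (in_exhaust (@vertex_code_inj d)) ltnNge kw.
have h i : is_child i w -> iter j recursion (- beta) <= boundary_msg k N tau (tree_step i w)
    <= iter j recursion beta.
  move=> iw; apply: IH; first exact: step_neq_origin.
    by rewrite step_child //= addSnnS.
  by apply: leq_trans kw _; rewrite addSnnS leq_add2l vertex_code_step.
rewrite [boundary_msg _ _ _ _]/= wN !iterS; apply/andP; split;
  apply: cavity_mono; rewrite lerD2l /child_sum -(count_children _ wr);
  by apply: ler_sum => i /h /andP[].
Qed.

(** A crude bound on the number of messages entering the energy: at most [d] at each vertex. *)
Definition bond_count n : R := \sum_(w <- exh n) \sum_(i < d) 1.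

Lemma energy_lipschitz n msg msg' eps sigma : 0 <= eps ->
  (forall i w, w \in exh n -> is_child i w ->
     `|msg (tree_step i w) - msg' (tree_step i w)| <= eps) ->
  energy beta B (exh n) msg sigma <=
  bond_count n * eps + energy beta B (exh n) msg' sigma.
Proof.
move=> eps0 close; rewrite -lerBlDr /energy -sumrB /bond_count mulr_suml.
rewrite big_seq [leRHS]big_seq; apply: ler_sum => w wn.
apply: (@le_trans _ _ (spin R (sigma w) *
    (outer_sum (exh n) msg w - outer_sum (exh n) msg' w))); first by lra.
rewrite mulr_suml -sumrB mulr_sumr big_mkcond /=; apply: ler_sum => i _.
rewrite mul1r; case: ifPn => // /andP[iw _].
apply: le_trans (ler_norm _) _; rewrite normrM -[leRHS]mul1r ler_pM //.
  by rewrite /spin; case: (sigma w); rewrite ?normrN normr1.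
exact: close.
Qed.

(** The boundary condition is encoded in the messages, and the volume is peeled from [exh N] down to
    [exh n]; the constant of [peel_down] cancels. *)
Lemma kernel_cylE n N zeta tau : (n <= N)%N ->
  ising_kernel (@tree_nbr d) beta B (exh N) (cyl (exh n) zeta) tau =
  gsum (exh n) (fun s => weight (exh n) (boundary_msg N N tau) s *
     \1_(cyl (exh n) zeta) s) tau /
  gsum (exh n) (weight (exh n) (boundary_msg N N tau)) tau.
Proof.
move=> nN; set msg := boundary_msg N N tau.
have [|C C0 CE] := @peel_down R d beta B n N msg nN.
  by move=> v vN _ _; exact: boundary_msgE.
have wE s : (forall v, v \notin exh N -> s v = tau v) ->
    bz (exh N) s = weight (exh N) msg s.
  move=> st; rewrite boltzmann_weightE; congr expR; apply: eq_bigr => w _.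
  congr (_ * (_ + _) + _); apply: eq_bigr => i /andP[_ iN].
  by rewrite /msg boundary_msg_out // st.
have den : gsum (exh N) (bz (exh N)) tau = C * gsum (exh n) (weight (exh n) msg) tau.
  have := CE (fun=> 1) tau (fun _ _ _ => erefl).
  under eq_gsum do rewrite mulr1.
  rewrite [in X in _ = X](eq_gsum (Psi := weight (exh n) msg)); last by move=> *; rewrite mulr1.
  by move=> <-; apply: eq_gsum => s /wE.
have num : gsum (exh N) (fun s => bz (exh N) s * \1_(cyl (exh n) zeta) s) tau =
    C * gsum (exh n) (fun s => weight (exh n) msg s * \1_(cyl (exh n) zeta) s) tau.
  rewrite -CE; first by apply: eq_gsum => s /wE ->.
  move=> s s' ss; rewrite !indicE; congr (nat_of_bool _)%:R.
  by apply/idP/idP; rewrite !inE => sz v vn; [rewrite -ss //|rewrite ss //]; exact: sz.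
rewrite /ising_kernel -/(gsum (exh N) (bz (exh N)) tau).
rewrite -/(gsum (exh N) (fun s => bz (exh N) s * \1_(cyl (exh n) zeta) s) tau).
by rewrite num den -mulf_div divff ?mul1r // gt_eqF.
Qed.

Lemma size_vertex_code (w : V) : (size (val w) <= vertex_code w)%N.
Proof.
rewrite /vertex_code; elim: (val w) => [//|i s IH] /=.
rewrite ltnS (leq_trans IH) // (leq_trans _ (leq_addr _ _)) // leq_pmulr //.
Qed.

Lemma weight_lipschitz n msg msg' eps sigma : 0 <= eps ->
  (forall i w, w \in exh n -> is_child i w ->
     `|msg (tree_step i w) - msg' (tree_step i w)| <= eps) ->
  weight (exh n) msg sigma <=
  expR (bond_count n * eps) * weight (exh n) msg' sigma.
Proof. by move=> eps0 close; rewrite -expRD ler_expR energy_lipschitz. Qed.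

(** Changing the boundary moves each message entering [exh n] by at most the gap between the extreme
    iterates; the square comes from the numerator and the denominator. *)
Lemma kernel_cyl_compare n N j zeta tau tau' :
  (n <= N)%N -> (forall v : V, (size (val v) < n + j)%N -> v \in exh N) ->
  ising_kernel (@tree_nbr d) beta B (exh N) (cyl (exh n) zeta) tau <=
  expR (bond_count n * (iter j recursion beta - iter j recursion (- beta))) ^+ 2 *
  ising_kernel (@tree_nbr d) beta B (exh N) (cyl (exh n) zeta) tau'.
Proof.
move=> nN ballN; set eps := _ - _; set E := expR _.
have bd t i w : w \in exh n -> is_child i w ->
    iter j recursion (- beta) <= boundary_msg N N t (tree_step i w) <= iter j recursion beta.
  move=> wn iw; apply: (@boundary_msg_iter N _ t ballN).
  - exact: step_neq_origin.
  - rewrite leq_add2r step_child //=; apply: leq_ltn_trans (size_vertex_code w) _.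
    by move: wn; rewrite (in_exhaust (@vertex_code_inj d)).
  - exact: leq_addr.
have eps0 : 0 <= eps by rewrite subr_ge0 iter_recursion_le.
have close t t' s : weight (exh n) (boundary_msg N N t) s <=
    E * weight (exh n) (boundary_msg N N t') s.
  apply: weight_lipschitz => // i w wn iw; rewrite ler_norml.
  by have := bd t i w wn iw; have := bd t' i w wn iw; rewrite /eps; lra.
rewrite !kernel_cylE //.
set num := gsum _ _ tau; set den := gsum _ _ tau.
(* Sums over [exh n] do not see the outer configuration; after this only the messages differ. *)
rewrite (gsum_boundary tau' tau) //; last first.
  move=> s s' ss; rewrite !indicE; congr (_ * _).
    by congr expR; apply: energy_local ss; exact: closed_up_exhaust.
  by congr (nat_of_bool _)%:R; apply/idP/idP; rewrite !inE => sz v vn;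
    [rewrite -ss //|rewrite ss //]; exact: sz.
rewrite (gsum_boundary tau' tau) //; last first.
  move=> s s' ss; congr expR; apply: energy_local ss; exact: closed_up_exhaust.
set num' := gsum _ _ tau; set den' := gsum _ _ tau.
have E0 : 0 < E by exact: expR_gt0.
have num0 : 0 <= num'.
  by apply: gsum_ge0 => s; rewrite mulr_ge0 // ltW // weight_gt0.
have den0 : 0 < den by apply: gsum_gt0 => s; exact: weight_gt0.
have den'0 : 0 < den' by apply: gsum_gt0 => s; exact: weight_gt0.
have hn : num <= E * num'.
  by rewrite -gsumZ; apply: ler_gsum => s; rewrite mulrA ler_wpM2r.
have hd : den' <= E * den by rewrite -gsumZ; apply: ler_gsum => s; exact: close.
rewrite ler_pdivrMr // expr2 -!mulrA; apply: le_trans hn _; rewrite ler_pM2l //.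
by rewrite mulrCA ler_peMr // mulrCA ler_pdivlMl // mulr1.
Qed.

(** Both measures average the same kernel. Comparing each average with the kernel at [xpredT] costs
    a factor [E ^+ 2], hence the fourth power. *)
Lemma gibbs_cyl_compare (P Q : probability (spin_space V) R) n j zeta :
  is_ising_gibbs (@tree_nbr d) beta B P -> is_ising_gibbs (@tree_nbr d) beta B Q ->
  fine (P (cyl (exh n) zeta)) <=
  expR (bond_count n * (iter j recursion beta - iter j recursion (- beta))) ^+ 4 *
  fine (Q (cyl (exh n) zeta)).
Proof.
move=> gP gQ; set E := expR _.
pose N := (d.+1 ^ (n + j))%N.
have nN : (n <= N)%N.
  by apply: leq_trans (leq_addr j n) _; apply: ltnW; rewrite ltn_expl.
have ballN (v : V) : (size (val v) < n + j)%N -> v \in exh N.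
  move=> vn; rewrite (in_exhaust (@vertex_code_inj d)).
  by apply: leq_trans (vertex_code_lt v) _; rewrite leq_exp2l // ltnW.
pose K := ising_kernel (@tree_nbr d) beta B (exh N) (cyl (exh n) zeta).
have KE tau tau' : K tau <= E ^+ 2 * K tau' by exact: kernel_cyl_compare.
have mK : measurable_fun setT (K : spin_space V -> R).
  by apply: measurable_ising_kernel; exact: measurable_cyl.
have K0 tau : 0 <= K tau by exact: ising_kernel_ge0.
have E0 : 0 < E by exact: expR_gt0.
have mc := measurable_cyl (exh n) zeta.
apply: (@le_trans _ _ (E ^+ 2 * K xpredT)).
  rewrite -lee_fin fineK ?fin_num_measure // (gP (exh N)) //.
  by apply: ge0_integral_le_cst => // tau; rewrite K0 KE.
rewrite (exprD E 2 2) -mulrA ler_pM2l ?exprn_gt0 //.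
rewrite -ler_pdivrMl ?exprn_gt0 // -lee_fin fineK ?fin_num_measure // (gQ (exh N)) //.
apply: ge0_cst_le_integral => //; first by rewrite mulr_ge0 // invr_ge0 exprn_ge0 // ltW.
by move=> tau; rewrite ler_pdivrMl ?exprn_gt0.
Qed.

Lemma gibbs_unique (P Q : probability (spin_space V) R) :
  (forall eps : R, 0 < eps ->
     exists j, iter j recursion beta - iter j recursion (- beta) <= eps) ->
  is_ising_gibbs (@tree_nbr d) beta B P -> is_ising_gibbs (@tree_nbr d) beta B Q ->
  forall A : set (spin_space V), measurable A -> P A = Q A.
Proof.
move=> contract gP gQ.
suff le P' Q' n zeta : is_ising_gibbs (@tree_nbr d) beta B P' ->
    is_ising_gibbs (@tree_nbr d) beta B Q' ->
    fine (P' (cyl (exh n) zeta)) <= fine (Q' (cyl (exh n) zeta)).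
  apply: (eq_prob_exhaustion (exhaust_cofinal (@vertex_code_inj d))) => n zeta.
  have mc := measurable_cyl (exh n) zeta.
  rewrite -[LHS]fineK ?fin_num_measure // -[RHS]fineK ?fin_num_measure //.
  by congr EFin; apply/eqP; rewrite eq_le !le.
move=> gP' gQ'; set x := fine _; set y := fine _.
have y0 : 0 <= y by exact/fine_ge0/measure_ge0.
rewrite leNgt; apply/negP => yx.
have bc0 : 0 <= bond_count n.
  by apply: sumr_ge0 => w _; apply: sumr_ge0.
have bound delta : 0 < delta -> x <= expR delta * y.
  (* The 4 matches the exponent in [gibbs_cyl_compare], and the added 1 keeps the denominator
     positive. *)
  move=> d0; have [|j hj] := contract (delta / (4 * (bond_count n + 1))).
    by rewrite divr_gt0 // mulr_gt0 // ltr_wpDl.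
  apply: le_trans (gibbs_cyl_compare n j zeta gP' gQ') _.
  rewrite ler_wpM2r // -expRM_natl ler_expR.
  move: hj; rewrite ler_pdivlMr ?mulr_gt0 ?ltr_wpDl //.
  have := iter_recursion_le j.
  set h := iter j _ beta; set l := iter j _ (- beta).
  by rewrite -mulr_natl => lh; nra.
have [y00|y00] := eqVneq y 0.
  by have := bound 1 ltr01; rewrite y00 mulr0 leNgt -{1}y00 yx.
have yp : 0 < y by rewrite lt_def y00.
have xy1 : 1 < x / y by rewrite ltr_pdivlMr // mul1r.
(* For this value the bound reads x / y <= sqrt (x / y), impossible as x / y > 1. *)
have := bound (ln (x / y) / 2); rewrite divr_gt0 ?ln_gt0 // => /(_ isT).
rewrite -ler_pdivrMr // leNgt => /negP; apply.
rewrite -[ltRHS]lnK ?posrE ?(lt_trans ltr01) // ltr_expR.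
by have := ln_gt0 xy1; lra.
Qed.

End TreeUniqueness.

(** * The cavity map and its fixed points *)

Section CavityMap.
Variables (R : realType) (beta : R).
Hypothesis beta_gt0 : 0 < beta.
Notation cavity := (cavity beta).
Let c : R := expR (- 2 * beta).

Let c_gt0 : 0 < c. Proof. exact: expR_gt0. Qed.
Let c_lt1 : c < 1.
Proof. by rewrite /c -[ltRHS](expR0 R) ltr_expR; move: beta_gt0; lra. Qed.

(** In the variable X = e^(2h), with c = e^(-2 beta), the cavity map is the Moebius map (X + c) / (1
    + c X), increasing because 1 - c^2 > 0. *)
Lemma cavityE h :
  cavity h = ln ((expR (2 * h) + c) / (1 + c * expR (2 * h))) / 2.
Proof.
rewrite /cavity; congr (ln _ / 2); rewrite /c.
have p x y : 0 < expR x + expR y :> R by rewrite addr_gt0 ?expR_gt0.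
have D1 := lt0r_neq0 (p (h - beta) (- h + beta)).
have D2 : 1 + expR (- 2 * beta) * expR (2 * h) != 0.
  by rewrite lt0r_neq0 // addr_gt0 ?mulr_gt0 ?expR_gt0.
apply/eqP; rewrite eqr_div //.
have -> : expR (- 2 * beta) = (expR beta ^+ 2)^-1.
  by rewrite -expRM_natl -expRN; congr expR; ring.
rewrite (expRM_natl 2) !expRD !expRN; apply/eqP.
by have := expR_gt0 h; have := expR_gt0 beta; move=> /lt0r_neq0 ? /lt0r_neq0 ?; field; apply/andP.
Qed.

Lemma cavity_cross x y : expR x <= expR y :> R ->
  (expR x + c) * (1 + c * expR y) <= (expR y + c) * (1 + c * expR x).
Proof.
move: c_gt0 c_lt1 => c0 c1; set X := expR x; set Y := expR y => XY.
rewrite -subr_ge0.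
have -> : (Y + c) * (1 + c * X) - (X + c) * (1 + c * Y) = (Y - X) * ((1 - c) * (1 + c)).
  by ring.
by rewrite !mulr_ge0 //; lra.
Qed.

Let num_gt0 h : 0 < expR (2 * h) + c.
Proof. by rewrite addr_gt0 ?expR_gt0. Qed.
Let den_gt0 h : 0 < 1 + c * expR (2 * h).
Proof. by rewrite addr_gt0 ?mulr_gt0 ?expR_gt0. Qed.

Lemma cavity_homo : {homo cavity : x y / x <= y}.
Proof.
move=> x y xy; rewrite !cavityE ler_pM2r ?invr_gt0 // ler_ln ?posrE ?divr_gt0 //.
rewrite ler_pdivrMr // mulrAC ler_pdivlMr //; apply: cavity_cross.
by rewrite ler_expR ler_pM2l.
Qed.

(** For X > 0 the Moebius map of [cavityE] takes values between c and 1 / c. *)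
Lemma cavity_norm_le h : `|cavity h| <= beta.
Proof.
move: c_gt0 c_lt1 => c0 c1.
have X0 : 0 < expR (2 * h) by exact: expR_gt0.
have cE : ln c = - 2 * beta by rewrite /c expRK.
rewrite cavityE ler_norml; apply/andP; split.
  suff : ln c <= ln ((expR (2 * h) + c) / (1 + c * expR (2 * h))) by rewrite cE; lra.
  rewrite ler_ln ?posrE ?divr_gt0 // ler_pdivlMr // mulrDr mulr1 mulrA addrC lerD2r.
  by rewrite ler_piMl 1?ltW //; nra.
suff : ln ((expR (2 * h) + c) / (1 + c * expR (2 * h))) <= - ln c by rewrite cE; lra.
rewrite -lnV ?posrE // ler_ln ?posrE ?divr_gt0 ?invr_gt0 // ler_pdivrMr //.
by rewrite ler_pdivlMl // mulrDr; nra.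
Qed.

Lemma cavity0 : cavity 0 = 0.
Proof.
rewrite cavityE mulr0 expR0 mulr1 divff ?ln1 ?mul0r //.
by rewrite gt_eqF // addr_gt0.
Qed.

Definition cavity_slope (h : R) : R :=
  expR (2 * h) * (1 - c ^+ 2) / ((expR (2 * h) + c) * (1 + c * expR (2 * h))).

Lemma is_derive_cavity (h : R) : is_derive h 1 cavity (cavity_slope h).
Proof.
have d2 : is_derive h 1 (fun x : R => 2 * x) (2 *: (1 : R)).
  exact: (@is_deriveZ _ _ _ id 2 h 1 1).
have dE : is_derive h 1 (fun x : R => expR (2 * x)) (expR (2 * h) * (2 *: (1 : R))).
  exact: (@is_derive1_comp _ expR (fun x => 2 * x)).
have dA : is_derive h 1 (fun x : R => expR (2 * x) + c)
    (expR (2 * h) * (2 *: (1 : R)) + 0).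
  exact: (@is_deriveD _ _ _ (fun x : R => expR (2 * x)) (cst c)).
have dB : is_derive h 1 (fun x : R => 1 + c * expR (2 * x))
    (0 + c *: (expR (2 * h) * (2 *: (1 : R)))).
  exact: (is_deriveD (is_derive_cst (1 : R) h 1) (is_deriveZ c dE)).
have dN := @is_derive1_comp _ (@ln R) _ h _ _ (is_derive1_ln (num_gt0 h)) dA.
have dD := @is_derive1_comp _ (@ln R) _ h _ _ (is_derive1_ln (den_gt0 h)) dB.
have -> : cavity = 2^-1 \*: (((@ln R) \o (fun x : R => expR (2 * x) + c)) -
    ((@ln R) \o (fun x : R => 1 + c * expR (2 * x)))).
  by apply/funext => x; rewrite cavityE ln_div ?posrE // mulrC.
apply: (is_derive_eq (is_deriveZ 2^-1 (is_deriveB dN dD))).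
rewrite /cavity_slope /GRing.scale /=.
have := num_gt0 h; have := den_gt0 h.
set X := expR _ => /lt0r_neq0 h1 /lt0r_neq0 h2; field.
by rewrite h1 h2.
Qed.

Lemma continuous_cavity : continuous cavity.
Proof.
by move=> h; apply: differentiable_continuous; apply/derivable1_diffP;
  have [] := is_derive_cavity h.
Qed.

(** The slope is (1 - c^2) / (1 + c^2 + c (X + 1/X)) with X = e^(2h), and X + 1/X increases for X >=
    1. *)
Lemma cavity_slope_anti a b : 0 <= a -> a <= b -> cavity_slope b <= cavity_slope a.
Proof.
move: c_gt0 c_lt1 => c0 c1 a0 ab; rewrite /cavity_slope.
have X1 : 1 <= expR (2 * a) by rewrite -[leLHS](expR0 R) ler_expR; lra.
have XY : expR (2 * a) <= expR (2 * b) by rewrite ler_expR; lra.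
have := num_gt0 a; have := num_gt0 b; have := den_gt0 a; have := den_gt0 b.
set X := expR (2 * a) in X1 XY *; set Y := expR (2 * b) in XY * => h1 h2 h3 h4.
rewrite ler_pdivrMr ?mulr_gt0 // mulrAC ler_pdivlMr ?mulr_gt0 //.
rewrite -subr_ge0.
have -> : X * (1 - c ^+ 2) * ((Y + c) * (1 + c * Y)) - Y * (1 - c ^+ 2) * ((X + c) * (1 + c * X))
  = (1 - c) * (1 + c) * c * ((Y - X) * (X * Y - 1)) by ring.
by rewrite !mulr_ge0 //; try lra; nra.
Qed.

(* [cavity] is concave on [0, +oo[ and vanishes at 0. *)
Lemma cavity_star_shaped a b : 0 < a -> a < b -> cavity b * a <= cavity a * b.
Proof.
move=> a0 ab.
have cts x y : {within `[x, y], continuous cavity}.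
  by apply: continuous_subspaceT; exact: continuous_cavity.
have [x] := MVT a0 (fun x _ => is_derive_cavity x) (cts 0 a).
have [y] := MVT ab (fun x _ => is_derive_cavity x) (cts a b).
rewrite !in_itv /= cavity0 !subr0 => /andP[ay yb] Ey /andP[x0 xa] Ex.
have := @cavity_slope_anti x y (ltW x0) (ltW (lt_trans xa ay)).
have -> : cavity b = cavity a + cavity_slope y * (b - a) by rewrite -Ey; ring.
rewrite Ex; set s := cavity_slope x; set t := cavity_slope y => ts.
rewrite -subr_ge0.
have -> : s * a * b - (s * a + t * (b - a)) * a = a * (b - a) * (s - t) by ring.
by rewrite !mulr_ge0 ?subr_ge0 // ltW.
Qed.

End CavityMap.

(** * Fixed points as limits of monotone orbits *)

Lemma iter_fixpoint_le (R : realType) (T : R -> R) (m x0 : R) :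
  {homo T : x y / x <= y} -> continuous T -> (forall x, m <= T x) -> T x0 <= x0 ->
  exists l, [/\ l <= x0, T l = l & iter n T x0 @[n --> \oo] --> l].
Proof.
move=> homoT contT lbT Tx0; pose u n := iter n T x0.
have u_dec : nonincreasing_seq u.
  by apply/nonincreasing_seqP; elim=> [//|n IH]; rewrite /u !iterS; apply: homoT.
have u_cvg : cvgn u.
  (* The minimum is needed for the starting point, which need not be a value of [T]. *)
  apply: nonincreasing_is_cvgn => //; exists (Num.min m x0) => _ [n _ <-].
  by case: n => [|n]; rewrite /u ?iterS ge_min ?lbT // lexx orbT.
exists (limn u); split; last exact: u_cvg.
  exact: (nonincreasing_cvgn_ge u_dec u_cvg 0%N).
have h1 : T (u n) @[n --> \oo] --> T (limn u).
  by apply: continuous_cvg; [exact: contT|exact: u_cvg].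
have h2 : T (u n) @[n --> \oo] --> limn u.
  by have := u_cvg; rewrite -[in X in X -> _](cvg_shiftS u).
exact: (cvg_unique _ h1 h2).
Qed.

(** Conjugation by negation turns an increasing orbit into a decreasing one. *)
Lemma iter_fixpoint_ge (R : realType) (T : R -> R) (m x0 : R) :
  {homo T : x y / x <= y} -> continuous T -> (forall x, T x <= m) -> x0 <= T x0 ->
  exists l, [/\ x0 <= l, T l = l & iter n T x0 @[n --> \oo] --> l].
Proof.
move=> homoT contT ubT Tx0.
have [|x|x||l [lx0 Tl cvgl]] := @iter_fixpoint_le R (fun x => - T (- x)) (- m) (- x0).
- by move=> x y xy; rewrite lerN2 homoT // lerN2.
- apply: cvgN; apply: continuous_cvg; [exact: contT|exact: cvgN].
- by rewrite lerN2.
- by rewrite opprK lerN2.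
exists (- l); split; [by rewrite lerNr|by rewrite -[in RHS]Tl opprK|].
have E n : iter n T x0 = - iter n (fun x => - T (- x)) (- x0).
  by elim: n => [|n IH]; rewrite /= ?opprK // -IH.
by under eq_fun do rewrite E; exact: cvgN.
Qed.

Section FixedPoints.
Variables (R : realType) (d : nat) (beta B : R).
Hypotheses (beta_gt0 : 0 < beta) (d_gt0 : (0 < d)%N).
Notation cavity := (cavity beta).
Notation recursion := (recursion d beta B).

Let homoT : {homo recursion : x y / x <= y}.
Proof. by apply: recursion_mono => //; exact: cavity_homo. Qed.

Lemma continuous_recursion : continuous recursion.
Proof.
move=> l; rewrite (_ : recursion = cavity \o (fun l => B + (d%:R - 1) * l)) //.
apply: continuous_comp; last exact: continuous_cavity.
  by apply: cvgD; [exact: cvg_cst|apply: cvgM; [exact: cvg_cst|exact: cvg_id]].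
Qed.

Let boundT l : - beta <= recursion l <= beta.
Proof. by rewrite -ler_norml cavity_norm_le. Qed.

(* [B = field_of h] iff [h = B + (d - 1) l] for a fixed message [l]. *)
Definition field_of (h : R) : R := h - (d%:R - 1) * cavity h.

(** The hypothesis on [h] makes [cavity h] decrease under [recursion], while 0 does not decrease as
    B >= 0. The two orbits end at fixed points on either side of 0; both can be 0 only if [cavity h]
    is 0, which would give B < h < 0. *)
Lemma two_fixed_messages h : 0 <= B -> h < 0 -> B < field_of h ->
  exists l1 l2 : R, [/\ recursion l1 = l1, recursion l2 = l2 & l1 != l2].
Proof.
move=> B0 h0 Bh.
have cav0 : cavity 0 = 0 by exact: cavity0.
have ch0 : cavity h <= 0 by rewrite -cav0; apply: cavity_homo => //; exact: ltW.
have [||l1 [l1h T1 _]] :=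
  @iter_fixpoint_le R recursion (- beta) (cavity h) homoT continuous_recursion.
- by move=> x; have /andP[] := boundT x.
- by apply: cavity_homo => //; move: Bh; rewrite /field_of; lra.
have [||l2 [l2h T2 _]] := @iter_fixpoint_ge R recursion beta 0 homoT continuous_recursion.
- by move=> x; have /andP[] := boundT x.
- by rewrite -{1}cav0; apply: cavity_homo => //; rewrite mulr0 addr0.
exists l1, l2; split=> //; rewrite lt_eqF //; apply: lt_le_trans l2h.
rewrite lt_neqAle (le_trans l1h ch0) andbT; apply/eqP => l10.
move: T1; rewrite l10 /recursion mulr0 addr0 => cB.
have ch : cavity h = 0 by apply/eqP; rewrite eq_le ch0 -{1}l10 l1h.
by move: Bh; rewrite /field_of ch mulr0; lra.
Qed.

(** A fixed message has total field h with [field_of h] equal to B, which excludes h < 0 by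
    hypothesis and h = 0 because B > 0. Concavity settles h > 0. *)
Lemma unique_fixed_message l1 l2 : 0 < B -> (forall h, h < 0 -> field_of h < B) ->
  recursion l1 = l1 -> recursion l2 = l2 -> l1 = l2.
Proof.
move=> B0 hB.
suff le l l' : recursion l = l -> recursion l' = l' -> l <= l'.
  by move=> T1 T2; apply/eqP; rewrite eq_le !le.
move=> T1 T2; rewrite leNgt; apply/negP => l'l.
pose h x : R := B + (d%:R - 1) * x.
have fh x : recursion x = x -> field_of (h x) = B.
  by move=> Tx; rewrite /field_of -[cavity _]/(recursion x) Tx /h; ring.
have h_gt0 x : recursion x = x -> 0 < h x.
  move=> Tx; have := fh x Tx; case: (ltgtP (h x) 0) => // [/hB + E|->].
    by rewrite E ltxx.
  by rewrite /field_of cavity0 // mulr0 subr0 => B00; move: B0; rewrite -B00 ltxx.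
have [d10|d10] := eqVneq (d%:R - 1 : R) 0.
  by move: T1 T2 l'l; rewrite /recursion d10 !mul0r => <- <-; rewrite ltxx.
have d1_gt0 : 0 < d%:R - 1 :> R by rewrite lt_def d10 subr_ge0 ler1n.
have hh : h l' < h l by rewrite ltrD2l ltr_pM2l.
(* After substituting the fixed-point equations the bilinear terms cancel, leaving B l <= B l',
   against l' < l. *)
have := cavity_star_shaped beta_gt0 (h_gt0 _ T2) hh.
rewrite -[cavity (h l)]/(recursion l) -[cavity (h l')]/(recursion l') T1 T2 /h.
by nra.
Qed.

Lemma recursion_contracts (eps : R) : 0 < B -> (forall h, h < 0 -> field_of h < B) ->
  0 < eps -> exists j, iter j recursion beta - iter j recursion (- beta) <= eps.
Proof.
move=> B0 hB eps0.
have [||l1 [_ T1 c1]] := @iter_fixpoint_le R recursion (- beta) beta homoT continuous_recursion.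
- by move=> x; have /andP[] := boundT x.
- by have /andP[] := boundT beta.
have [||l2 [_ T2 c2]] := @iter_fixpoint_ge R recursion beta (- beta) homoT continuous_recursion.
- by move=> x; have /andP[] := boundT x.
- by have /andP[] := boundT (- beta).
have E := unique_fixed_message B0 hB T1 T2.
have : iter n recursion beta - iter n recursion (- beta) @[n --> \oo] --> l1 - l2.
  exact: cvgB.
rewrite E subrr => /cvgrPdist_le /(_ eps eps0)[n _ /(_ n (leqnn n))].
by rewrite sub0r normrN => /(le_trans (ler_norm _)) h; exists n.
Qed.

End FixedPoints.

(** * The annealed critical field *)

Section Annealed.
Variables (R : realType) (d : nat) (beta : R).
Hypothesis beta_gt0 : 0 < beta.
Notation cavity := (cavity beta).
Notation f := (f_ann beta).
Let c : R := expR (- 2 * beta).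

Let c_gt0 : 0 < c. Proof. exact: expR_gt0. Qed.
Let c_lt1 : c < 1.
Proof. by rewrite /c -[ltRHS](expR0 R) ltr_expR; move: beta_gt0; lra. Qed.

Let f_annE (t : R) : f t = (c * (1 - 2 * t) +
  Num.sqrt (1 + (c ^+ 2 - 1) * (1 - 2 * t) ^+ 2)) / (2 * (1 - t)).
Proof.
rewrite /f_ann (_ : expR (- 4 * beta) = c ^+ 2) // /c -expRM_natl.
by congr expR; ring.
Qed.

Let disc_gt0 (t : R) : 0 <= t <= 1 / 2 -> 0 < 1 + (c ^+ 2 - 1) * (1 - 2 * t) ^+ 2.
Proof.
move: c_gt0 c_lt1 => c0 c1 /andP[t0 t1].
have : (1 - 2 * t) ^+ 2 <= 1 by rewrite expr_le1 //; lra.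
have := sqr_ge0 (1 - 2 * t); set u := (1 - 2 * t) ^+ 2 => u0 u1.
have c2 : 0 < c ^+ 2 by rewrite exprn_gt0.
have : 0 <= (1 - c ^+ 2) * (1 - u).
  by rewrite mulr_ge0 ?subr_ge0 // expr_le1 // ltW.
lra.
Qed.

Lemma f_ann_gt0 (t : R) : 0 <= t <= 1 / 2 -> 0 < f t.
Proof.
move=> tI; have := disc_gt0 tI; move: c_gt0 tI => c0 /andP[t0 t1] D0.
rewrite f_annE divr_gt0 //; last by lra.
by rewrite ltr_wpDl ?sqrtr_gt0 // mulr_ge0 ?(ltW c0) //; lra.
Qed.

(* [f_ann beta t] is the positive root of this quadratic; its roots have product
   [- t / (1 - t) < 0]. *)
Definition annealed_quadratic (t y : R) : Prop :=
  (1 - t) * y ^+ 2 - c * (1 - 2 * t) * y - t = 0.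

Lemma f_ann_root (t : R) : 0 <= t <= 1 / 2 -> annealed_quadratic t (f t).
Proof.
move=> tI; have := sqr_sqrtr (ltW (disc_gt0 tI)).
rewrite /annealed_quadratic f_annE; set q := Num.sqrt _ => q2.
have t1 : 1 - t != 0 by case/andP: tI => ? ?; rewrite gt_eqF //; lra.
have -> : (1 - t) * ((c * (1 - 2 * t) + q) / (2 * (1 - t))) ^+ 2 -
   c * (1 - 2 * t) * ((c * (1 - 2 * t) + q) / (2 * (1 - t))) - t =
   (q ^+ 2 - c ^+ 2 * (1 - 2 * t) ^+ 2 - 4 * t * (1 - t)) / (4 * (1 - t)) by field.
by rewrite q2 (_ : _ - 4 * t * (1 - t) = 0) ?mul0r //; ring.
Qed.

Lemma annealed_quadratic_inj (t y y' : R) : 0 < t <= 1 / 2 -> 0 < y -> 0 < y' ->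
  annealed_quadratic t y -> annealed_quadratic t y' -> y = y'.
Proof.
rewrite /annealed_quadratic => /andP[t0 t1] y0 y'0 E E'.
have : (y - y') * ((1 - t) * (y + y') - c * (1 - 2 * t)) = 0.
  rewrite -[RHS](subrr 0) -{1}E -E'; ring.
move/eqP; rewrite mulf_eq0 subr_eq0 => /orP[/eqP //|/eqP E2].
have : (1 - t) * y * y' + t = 0.
  rewrite (_ : _ + t = y * ((1 - t) * (y + y') - c * (1 - 2 * t)) -
    ((1 - t) * y ^+ 2 - c * (1 - 2 * t) * y - t)); last by ring.
  by rewrite E2 E mulr0 subr0.
have : 0 < (1 - t) * y * y' by rewrite !mulr_gt0 //; lra.
lra.
Qed.

Definition annealed_field (t : R) : R := ln (t / (1 - t) / f t) / 2.

Lemma annealed_field_lt0 (t : R) : 0 < t < 1 / 2 -> annealed_field t < 0.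
Proof.
move=> /andP[t0 t1].
have tI : 0 <= t <= 1 / 2 by apply/andP; split; lra.
have f0 := f_ann_gt0 tI; have := f_ann_root tI; rewrite /annealed_quadratic => E.
have t1' : 0 < 1 - t by lra.
rewrite /annealed_field pmulr_llt0 ?invr_gt0 //; apply: ln_lt0.
apply/andP; split; first by rewrite divr_gt0 // divr_gt0.
rewrite ltr_pdivrMr // mul1r ltr_pdivrMr //.
(* Otherwise f t <= t / (1 - t) < 1, so (1 - t) (f t)^2 <= t and the quadratic would be negative. *)
rewrite ltNge; apply/negP => ft.
have h1 : (1 - t) * f t ^+ 2 <= t * f t by rewrite expr2 mulrA ler_pM2r // mulrC.
have h2 : t * f t <= t by nra.
have u0 : 0 < 1 - 2 * t by lra.
have h3 : 0 < c * (1 - 2 * t) * f t by rewrite mulr_gt0 // mulr_gt0 // c_gt0.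
lra.
Qed.

(** With X = t / ((1 - t) f t), clearing denominators in (X + c) / (1 + c X) = f t gives the
    quadratic satisfied by f t. *)
Lemma cavity_annealed_field (t : R) : 0 < t < 1 / 2 ->
  cavity (annealed_field t) = ln (f t) / 2.
Proof.
move=> /andP[t0 t1].
have tI : 0 <= t <= 1 / 2 by apply/andP; split; lra.
have f0 := f_ann_gt0 tI; have := f_ann_root tI; rewrite /annealed_quadratic => E.
have t1' : 0 < 1 - t by lra.
rewrite cavityE -/c; congr (ln _ / 2).
have -> : expR (2 * annealed_field t) = t / (1 - t) / f t.
  rewrite /annealed_field mulrC divfK ?pnatr_eq0 // lnK // posrE divr_gt0 // divr_gt0 //.
have den : 1 + c * (t / (1 - t) / f t) != 0.
  by rewrite gt_eqF // addr_gt0 // mulr_gt0 ?c_gt0 // divr_gt0 // divr_gt0.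
have f1 := lt0r_neq0 f0; have t2 := lt0r_neq0 t1'.
apply: (mulIf den); rewrite divfK //; apply: (mulIf f1); apply: (mulIf t2).
move: f1 t2 E; set y := f t => f1 t2 E.
transitivity (t + c * y * (1 - t)); first by field; rewrite f1 t2.
transitivity ((1 - t) * y ^+ 2 + c * t * y); first by lra.
by field; rewrite f1 t2.
Qed.

Lemma field_of_annealed_field (t : R) : 0 < t < 1 / 2 ->
  field_of d beta (annealed_field t) = - (1 / 2) * (ln ((1 - t) / t) + d%:R * ln (f t)).
Proof.
move=> tI; rewrite /field_of cavity_annealed_field // /annealed_field.
move: tI => /andP[t0 t1].
have tI : 0 <= t <= 1 / 2 by apply/andP; split; lra.
have f0 := f_ann_gt0 tI; have t1' : 0 < 1 - t by lra.
have rt0 : 0 < t / (1 - t) by rewrite divr_gt0.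
have -> : ln (t / (1 - t) / f t) = ln t - ln (1 - t) - ln (f t).
  by rewrite (ln_div rt0) // ln_div ?posrE.
have -> : ln ((1 - t) / t) = ln (1 - t) - ln t by rewrite ln_div ?posrE.
by field.
Qed.

Lemma annealed_field_surj h : h < 0 -> exists2 t, 0 < t < 1 / 2 & annealed_field t = h.
Proof.
move=> h0; pose X := expR (2 * h); have X0 : 0 < X by exact: expR_gt0.
have X1 : X < 1 by rewrite /X -[ltRHS](expR0 R) ltr_expR; lra.
move: c_gt0 c_lt1 => c0 c1.
have den0 : 0 < 1 + c * X by rewrite addr_gt0 ?mulr_gt0.
(* This is e^(2 cavity h), the value f t must take. Then t is determined by t / (1 - t) = X y, and X
   y < 1 puts it below 1/2. *)
pose y := (X + c) / (1 + c * X); have y0 : 0 < y by rewrite /y divr_gt0 // addr_gt0.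
have y1 : y < 1.
  have : 0 < (1 - c) * (1 - X) by rewrite mulr_gt0 ?subr_gt0.
  by rewrite /y ltr_pdivrMr // mul1r; lra.
have Xy0 : 0 < X * y by exact: mulr_gt0.
have Xy1 : X * y < 1 by nra.
pose t := X * y / (1 + X * y); have r0 : 0 < 1 + X * y by lra.
have t0 : 0 < t by rewrite divr_gt0.
have t1 : t < 1 / 2 by rewrite ltr_pdivrMr // mul1r ltr_pdivlMl //; lra.
have tE : t / (1 - t) = X * y.
  rewrite /t; field; rewrite (lt0r_neq0 r0) /= addrK oner_eq0 //.
exists t; first by rewrite t0 t1.
have tI : 0 <= t <= 1 / 2 by rewrite !ltW.
have fy : f t = y.
  apply: (@annealed_quadratic_inj t) => //; [by rewrite t0 ltW|exact: f_ann_gt0|exact: f_ann_root|].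
  rewrite /annealed_quadratic.
  have -> : (1 - t) * y ^+ 2 - c * (1 - 2 * t) * y - t =
      (1 - t) * (y ^+ 2 - c * (1 - t / (1 - t)) * y - t / (1 - t)) by field; rewrite gt_eqF //; lra.
  rewrite tE (_ : _ - X * y = y * (y * (1 + c * X) - (X + c))); last by ring.
  by rewrite divfK ?lt0r_neq0 // subrr !mulr0.
by rewrite /annealed_field tE fy mulfK ?lt0r_neq0 // expRK mulrC mulKf ?pnatr_eq0.
Qed.

End Annealed.

Lemma is_derive_entropy (R : realType) (t : R) : 0 < t < 1 ->
  is_derive t 1 (@entropy R) (ln ((1 - t) / t)).
Proof.
move=> /andP[t0 t1]; have t1' : 0 < 1 - t by rewrite subr_gt0.
have dL := is_deriveB (is_derive_id t 1) (is_derive_cst (1 : R) t 1).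
have dR := is_deriveB (is_derive_cst (1 : R) t 1) (is_derive_id t 1).
have dln := @is_derive1_comp _ (@ln R) (cst 1 - id) t _ _ (is_derive1_ln t1') dR.
have d1 := is_deriveM dL dln.
have d2 := is_deriveM (is_derive_id t 1) (is_derive1_ln t0).
apply: (is_derive_eq (is_deriveB d1 d2)).
rewrite ln_div ?posrE // /GRing.scale /= !fctE /=.
by field; rewrite !lt0r_neq0.
Qed.

(** * The derivative of the annealed functional *)

Section AnnealedDerivative.
Variables (R : realType) (d : nat) (beta : R).
Hypothesis beta_gt0 : 0 < beta.
Notation f := (f_ann beta).

Lemma continuous_ln_f_ann (s : R) : 0 <= s <= 1 / 2 ->
  {for s, continuous (fun s => ln (f s))}.
Proof.
move=> sI; have f0 := f_ann_gt0 beta_gt0 sI.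
apply: (@continuous_comp _ _ _ f (@ln R)); last exact: continuous_ln.
have cu : {for s, continuous (fun s : R => 1 - 2 * s)}.
  by apply: cvgB; [exact: cvg_cst|apply: cvgM; [exact: cvg_cst|exact: cvg_id]].
rewrite /f_ann; apply: cvgM.
  apply: cvgD; first by apply: cvgM => //; exact: cvg_cst.
  apply: (@continuous_comp _ _ _
    (fun s : R => 1 + (expR (- 4 * beta) - 1) * (1 - 2 * s) ^+ 2) (@Num.sqrt R)).
    apply: cvgD; first exact: cvg_cst.
    by apply: cvgM; [exact: cvg_cst|apply: cvgM].
  exact: sqrt_continuous.
apply: cvgV; first by rewrite mulf_neq0 ?pnatr_eq0 // subr_eq0 eq_sym lt_eqF //; lra.
apply: cvgM; first exact: cvg_cst.
by apply: cvgB; [exact: cvg_cst|exact: cvg_id].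
Qed.

Lemma derive1_phi_ann (t : R) : 0 < t < 1 / 2 ->
  derive1 (phi_ann d beta) t = ln ((1 - t) / t) + d%:R * ln (f t).
Proof.
move=> /andP[t0 t1].
pose F (y : R) := Rintegral lebesgue_measure `[0, y] (fun s => ln (f s)).
have [dF F'] : derivable F t 1 /\ derive1 F t = ln (f t).
  apply: (@continuous_FTC1_closed _ _ _ _ (1 / 2)) => //.
    apply: continuous_compact_integrable; first exact: segment_compact.
    apply: continuous_in_subspaceT => s; rewrite inE /= in_itv /=.
    exact: continuous_ln_f_ann.
  by apply: continuous_ln_f_ann; rewrite !ltW.
have dF' : is_derive t 1 F (ln (f t)).
  by rewrite -F' derive1E; exact: derivableP.
have dI : is_derive t 1 (@entropy R) (ln ((1 - t) / t)).
  by apply: is_derive_entropy; rewrite t0 /=; lra.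
have dG := is_deriveD (is_deriveD (is_derive_cst (beta * d%:R / 2) t 1) dI)
  (is_deriveZ d%:R dF').
have dP : is_derive t 1 (phi_ann d beta) (0 + ln ((1 - t) / t) + d%:R *: ln (f t)).
  (* Near a point below 1/2 the upper limit min(x, 1 - x) is x itself. *)
  apply: near_eq_is_derive dG; near=> x.
  have x1 : x < 1 / 2 by near: x; exact: lt_nbhsl.
  by rewrite /phi_ann min_l //; lra.
by rewrite derive1E; have [_ ->] := dP; rewrite add0r.
Unshelve. all: by end_near. Qed.

Lemma annealed_value (t : R) : 0 < t < 1 / 2 ->
  - (1 / 2) * derive1 (phi_ann d beta) t = field_of d beta (annealed_field beta t).
Proof. by move=> tI; rewrite field_of_annealed_field // derive1_phi_ann. Qed.

End AnnealedDerivative.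

(** * Equality of the two critical fields *)

Lemma critical_field_annealedE (R : realType) (d : nat) (beta : R) : 0 < beta ->
  critical_field_annealed d beta =
  ereal_sup [set (field_of d beta h)%:E | h in [set h : R | h < 0]].
Proof.
move=> b0; congr ereal_sup; apply/seteqP; split => _ [t /= tI <-].
  exists (annealed_field beta t); first exact: annealed_field_lt0.
  by rewrite annealed_value.
have [s sI <-] := annealed_field_surj b0 tI.
by exists s => //; rewrite annealed_value.
Qed.

Lemma beta_crit_gt0 (R : realType) (d : nat) : (3 <= d)%N -> 0 < beta_crit R d.
Proof.
move=> d3; have d2 : 2 <= d%:R - 1 :> R.
  by have : 3%:R <= d%:R :> R; [rewrite ler_nat|lra].
have : (d%:R - 1)^-1 <= 2^-1 :> R by rewrite lef_pV2 ?posrE //; lra.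
have : 0 < (d%:R - 1)^-1 :> R by rewrite invr_gt0; lra.
rewrite /beta_crit /atanh; set x := (_ - 1)^-1 => x0 x1.
by rewrite divr_gt0 // ln_gt0 // ltr_pdivlMr; lra.
Qed.

(** Existence comes from the fixed message reached by the orbit of [beta], uniqueness from the two
    extreme orbits having the same limit. *)
Lemma unique_above (R : realType) (d : nat) (beta B : R) : 0 < beta -> (0 < d)%N ->
  0 < B -> (forall h, h < 0 -> field_of d beta h < B) ->
  unique_ising_gibbs (@tree_nbr d) beta B.
Proof.
move=> b0 d0 B0 hB.
have bdd x : - beta <= recursion d beta B x <= beta.
  by rewrite -ler_norml cavity_norm_le.
have [||||l [_ Tl _]] := @iter_fixpoint_le R (recursion d beta B) (- beta) beta.
- by apply: recursion_mono => //; exact: cavity_homo.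
- exact: continuous_recursion.
- by move=> x; have /andP[] := bdd x.
- by have /andP[] := bdd beta.
have [P gP _] := exists_ising_gibbs (esym Tl).
exists P; split=> // Q gQ A mA.
apply: (gibbs_unique d0 (cavity_homo b0) (cavity_norm_le b0) _ gQ gP mA).
by move=> eps; exact: (recursion_contracts b0 d0 B0 hB).
Qed.

(** The measures built from two fixed messages differ already in the spin at the origin, whose
    effective field is B + d l. *)
Lemma not_unique_below (R : realType) (d : nat) (beta B h : R) : 0 < beta -> (0 < d)%N ->
  0 <= B -> h < 0 -> B < field_of d beta h ->
  ~ unique_ising_gibbs (@tree_nbr d) beta B.
Proof.
move=> b0 d0 B0 h0 Bh [mu [_ uniq]].
have [l1 [l2 [T1 T2 l12]]] := two_fixed_messages b0 d0 B0 h0 Bh.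
have [P1 g1 E1] := exists_ising_gibbs (esym T1).
have [P2 g2 E2] := exists_ising_gibbs (esym T2).
have n1 : exhaust (@vertex_code d) 1 = [fset origin d]%fset.
  apply/fsetP => v; rewrite (in_exhaust (@vertex_code_inj d)) inE ltnS leqn0.
  by apply/eqP/eqP => [v0|->] //; apply: vertex_code_inj.
have pE (l : R) (P : probability (spin_space (tree_vertex d)) R) :
    (forall n zeta, P (cyl (exhaust (@vertex_code d) n) zeta) =
      (weight beta B (exhaust (@vertex_code d) n) (fun=> l) zeta /
       @partition_fun R d beta B n (fun=> l))%:E) ->
    forall b, P (cyl [fset origin d]%fset (fun=> b)) =
      (expR (spin R b * (B + d%:R * l)) / @partition_fun R d beta B 1 (fun=> l))%:E.
  move=> PE b; rewrite -n1 PE n1; congr (expR _ / _)%:E.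
  rewrite /energy big_seq_fset1 /parent_bond eqxx addr0 /outer_sum.
  rewrite (eq_bigl (fun i => is_child i (origin d))) ?count_origin_children // => i.
  by case ic : (is_child i _) => //=; rewrite inE step_neq_origin.
have same b : P1 (cyl [fset origin d]%fset (fun=> b)) = P2 (cyl [fset origin d]%fset (fun=> b)).
  by rewrite (uniq P1) // ?(uniq P2) //; exact: measurable_cyl.
have := same true; have := same false.
rewrite !(pE l1 P1) // !(pE l2 P2) // => -[Ef] [Et].
have Z1 := @partition_fun_gt0 R d beta B 1 (fun=> l1).
have Z2 := @partition_fun_gt0 R d beta B 1 (fun=> l2).
move: Et Ef; rewrite /spin mul1r mul1r !mulN1r !expRN.
set a1 := expR (B + _ * l1); set a2 := expR (B + _ * l2) => Et Ef.
have a10 : 0 < a1 by exact: expR_gt0.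
have a20 : 0 < a2 by exact: expR_gt0.
set z1 := partition_fun _ _ _ _ in Et Ef Z1; set z2 := partition_fun _ _ _ _ in Et Ef Z2.
have e1 : a1 * z2 = a2 * z1.
  by apply/eqP; rewrite -eqr_div ?lt0r_neq0 //; apply/eqP.
have e2 : a2 * z2 = a1 * z1.
  have := Ef => /(congr1 (fun x => x * (a1 * a2 * z1 * z2))).
  have -> : a1^-1 / z1 * (a1 * a2 * z1 * z2) = a2 * z2 by field; rewrite !lt0r_neq0.
  by have -> : a2^-1 / z2 * (a1 * a2 * z1 * z2) = a1 * z1 by field; rewrite !lt0r_neq0.
(* Equal probabilities for both spins give a1^2 = a2^2, hence equal effective fields. *)
have /eqP : (a1 - a2) * ((a1 + a2) * z2) = 0.
  rewrite (_ : _ * _ = a1 * (a1 * z2) - a2 * (a2 * z2)); last by ring.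
  by rewrite e1 e2; ring.
rewrite mulf_eq0 subr_eq0 (gt_eqF (mulr_gt0 (addr_gt0 a10 a20) Z2)) orbF => /eqP /expR_inj.
move=> /addrI /mulfI E; move/eqP: l12; apply; apply: E.
by rewrite pnatr_eq0 -lt0n.
Qed.

Theorem proposition1p5 (R : realType) (d : nat) (hd : (3 <= d)%N)
    (beta : R) (hbeta : beta_crit R d < beta) :
  critical_field_gibbs d beta = critical_field_annealed d beta.
Proof.
have b0 : 0 < beta by exact: lt_trans (beta_crit_gt0 R hd) hbeta.
have d0 : (0 < d)%N by exact: leq_trans hd.
rewrite critical_field_annealedE //; set S := ereal_sup _.
have fS h : h < 0 -> ((field_of d beta h)%:E <= S)%E.
  by move=> h0; apply: ereal_sup_ubound; exists h.
apply/eqP; rewrite eq_le; apply/andP; split; last first.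
  apply: ge_ereal_sup => _ [h h0 <-]; apply: le_ereal_inf_tmp => _ [B [B0 uB] <-].
  rewrite lee_fin leNgt; apply/negP => Bh.
  exact: (not_unique_below b0 d0 B0 h0 Bh uB).
(* Letting [h] tend to 0 gives S >= 0, so that every B above S is positive and admissible in the
   infimum. *)
have gh h : h < 0 -> h <= field_of d beta h.
  move=> h0; have : cavity beta h <= 0.
    by rewrite -(cavity0 beta); apply: cavity_homo => //; exact: ltW.
  have : 0 <= d%:R - 1 :> R by rewrite subr_ge0 ler1n.
  by rewrite /field_of; nra.
have above B : 0 < B -> (S < B%:E)%E -> (critical_field_gibbs d beta <= B%:E)%E.
  move=> B0 SB; apply: ereal_inf_lbound; exists B => //; split; first exact: ltW.
  apply: unique_above => // h h0; rewrite -lte_fin; exact: le_lt_trans (fS h h0) SB.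
case E : S => [s| |]; rewrite ?leey //; last first.
  by have := fS (- 1) (ltrN10 R); rewrite E leeNy_eq.
have s0 : 0 <= s.
  rewrite leNgt; apply/negP => s0; have h0 : s / 2 < 0 by lra.
  by have := fS _ h0; have := gh _ h0; rewrite E lee_fin; lra.
apply/lee_addgt0Pr => e e0; rewrite -EFinD; apply: above.
  exact: ltr_wpDl.
by rewrite E lte_fin ltrDl.
Qed.
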